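(* Let $x,y\in\mathbb{C}$ with $x+iy,\,x-iy\notin\{0,-1,-2,\ldots\}$. With infinite products over $m$ understood as zeta-regularized products, $$\prod_{m=0}^\infty\left((m+x)^2+y^2\right)^{(-1)^m}=\prod_{m=0}^\infty\left((m+x+iy)(m+x-iy)\right)^{(-1)^m}=\frac{\pi/2}{\tilde\Gamma(x+iy)\,\tilde\Gamma(x-iy)}.$$
   Context: Complex powers use the principal branch. For a sequence $(a_m)_{m\ge0}$ of nonzero complex numbers, the zeta-regularized product $\prod_{m=0}^\infty a_m^{(-1)^m}$ is $\exp(-F'(0))$, where $F(s)=\sum_{m=0}^\infty(-1)^ma_m^{-s}$ for $\mathrm{Re}(s)>0$, analytically continued to a neighbourhood of $s=0$ (existence of the continuation being part of the assertion); when $a_m$ is written as a finite product $\prod_jb_{m,j}$, $a_m^{-s}$ is read as $\prod_jb_{m,j}^{-s}$. The modified gamma function is $$\tilde\Gamma(x)=\frac1x e^{x\log 2}\prod_{m=1}^\infty\left(e^{-x/m}\left(1+\frac xm\right)\right)^{(-1)^{m+1}},\qquad x\in\mathbb{C}\setminus\{0,-1,-2,\ldots\},$$ with this last infinite product an ordinary convergent product. *)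

(* Defs.v *)
From Stdlib Require Import Reals Lra List.
From Coquelicot Require Import Coquelicot.
Import ListNotations.

Open Scope R_scope.

Definition Cexp (z : C) : C :=
  (exp (Re z) * cos (Im z), exp (Re z) * sin (Im z)).

(* Principal argument, with values in (-PI, PI]; irrelevant at 0. *)
Definition Carg (z : C) : R :=
  if Rle_dec 0 (Im z) then acos (Re z / Cmod z) else - acos (Re z / Cmod z).

Definition Clog (z : C) : C := (ln (Cmod z), Carg z).

Lemma Cexp_Clog (z : C) : z <> 0%C -> Cexp (Clog z) = z.
Proof.
intros Hz.
assert (Hr : 0 < Cmod z) by now apply Cmod_gt_0.
destruct z as [a b].
assert (Hsq : Cmod (a, b) * Cmod (a, b) = a * a + b * b).
{ unfold Cmod; simpl; rewrite sqrt_sqrt; nra. }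
unfold Cexp, Clog, Carg; unfold Re, Im; cbn [fst snd].
set (r := Cmod (a, b)) in *; clearbody r.
rewrite (exp_ln r Hr).
assert (Ht : -1 <= a / r <= 1).
{ split.
  - apply Rmult_le_reg_r with r; [exact Hr|]; unfold Rdiv.
    rewrite Rmult_assoc, Rinv_l; nra.
  - apply Rmult_le_reg_r with r; [exact Hr|]; unfold Rdiv.
    rewrite Rmult_assoc, Rinv_l; nra. }
assert (Hs : sqrt (1 - Rsqr (a / r)) = Rabs b / r).
{ replace (1 - Rsqr (a / r)) with (Rsqr (Rabs b / r)).
  - apply sqrt_Rsqr; apply Rmult_le_pos; [apply Rabs_pos|].
    now apply Rlt_le, Rinv_0_lt_compat.
  - rewrite Rsqr_div', <- Rsqr_abs, Rsqr_div'; unfold Rsqr; rewrite Hsq.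
    field; nra. }
destruct (Rle_dec 0 b) as [Hb | Hb].
- rewrite cos_acos, sin_acos, Hs by exact Ht.
  rewrite Rabs_pos_eq by exact Hb; f_equal; field; lra.
- rewrite cos_neg, sin_neg, cos_acos, sin_acos, Hs by exact Ht.
  rewrite Rabs_left by lra; f_equal; field; lra.
Qed.

Lemma Carg_bound (z : C) : z <> 0%C -> - PI < Carg z <= PI.
Proof.
intros Hz; unfold Carg.
destruct (acos_bound (Re z / Cmod z)) as [H0 H1].
pose proof PI_RGT_0 as Hpi.
destruct (Rle_dec 0 (Im z)) as [Hb | Hb]; [lra|].
split; [|lra].
destruct (Req_dec (acos (Re z / Cmod z)) PI) as [E | E]; [exfalso|lra].
assert (Hs : Im (Cexp (Clog z)) = 0).
{ unfold Clog, Carg; destruct (Rle_dec 0 (Im z)) as [Hc | Hc]; [lra|].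
  unfold Cexp, Im; cbn [fst snd]; fold (Im z).
  rewrite E, sin_neg, sin_PI; ring. }
rewrite (Cexp_Clog z Hz) in Hs; lra.
Qed.

Definition Cpower (z s : C) : C := Cexp (s * Clog z)%C.

Definition Cprod (l : list C) : C := fold_right Cmult 1%C l.

(* [z ^ ((-1) ^ n)] *)
Definition Calt_pow (z : C) (n : nat) : C := if Nat.even n then z else (/ z)%C.

(* A term [a_m] is given by the list of the factors [b_(m,j)] in which it is
   written, since [a_m ^ (-s)] depends on that way of writing it. *)
Definition zeta_term (b : list C) (s : C) : C :=
  Cprod (map (fun z => Cpower z (- s)%C) b).

(* [p] is the zeta-regularized product of the [(Cprod (b m)) ^ ((-1) ^ m)].
   [F] is the sum of the series for [Re s > 0] together with its continuation
   to some disc about 0; the half-plane and the disc have a connected union,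
   and the value does not depend on [F] (see [is_zeta_prod_unique]). *)
Definition is_zeta_prod (b : nat -> list C) (p : C) : Prop :=
  (forall m z, In z (b m) -> z <> 0%C) /\
  exists (F : C -> C) (d : C),
    (forall s : C, 0 < Re s ->
       ex_derive F s /\
       is_series (V := C_NormedModule)
         (fun m => ((-1) ^ m * zeta_term (b m) s)%C) (F s)) /\
    locally (RtoC 0) (fun s => ex_derive F s) /\
    is_derive F (RtoC 0) d /\
    p = Cexp (- d)%C.

Lemma is_zeta_prod_unique (b : nat -> list C) (p q : C) :
  is_zeta_prod b p -> is_zeta_prod b q -> p = q.
Proof.
intros [_ [F [d [HF [_ [HFd ->]]]]]] [_ [G [e [HG [_ [HGe ->]]]]]].
assert (Heq : forall t : R, 0 < t -> F (RtoC t) = G (RtoC t)).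
{ intros t Ht.
  apply (filterlim_locally_unique (V := C_NormedModule) (F := eventually))
    with (1 := proj2 (HF (RtoC t) Ht)) (2 := proj2 (HG (RtoC t) Ht)). }
assert (HH := is_derive_minus F G (RtoC 0) d e HFd HGe).
set (H := (fun x => F x - G x)%C : C -> C).
assert (H0 : forall t : R, 0 < t -> H (RtoC t) = 0%C).
{ intros t Ht; unfold H; rewrite (Heq t Ht); ring. }
change (is_derive H (RtoC 0) (Cminus d e)) in HH.
set (l := (d - e)%C) in *.
assert (Hl : l = 0%C).
{ destruct HH as [_ HH].
  specialize (HH (RtoC 0) (fun P HP => HP)).
  assert (Hb : forall eps : posreal, exists r : posreal, forall t : R,
             0 < t < r -> Cmod (H (RtoC 0) + t * l)%C <= eps * t).
  { intros eps; destruct (HH eps) as [r Hr]; exists r; intros t Ht.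
    specialize (Hr (RtoC t)).
    assert (Hbt : ball (M := AbsRing_UniformSpace C_AbsRing) (RtoC 0) r (RtoC t)).
    { change (Cmod (RtoC t - RtoC 0)%C < r).
      rewrite <- RtoC_minus, Cmod_R, Rabs_pos_eq; lra. }
    specialize (Hr Hbt); rewrite (H0 t) in Hr by lra.
    change (Cmod ((0 - H (RtoC 0)) - (RtoC t - RtoC 0) * l)%C
            <= eps * Cmod (RtoC t - RtoC 0)%C) in Hr.
    rewrite <- RtoC_minus, Cmod_R, Rabs_pos_eq, Rminus_0_r in Hr by lra.
    rewrite <- Cmod_opp.
    replace (- (H (RtoC 0) + t * l))%C with (0 - H (RtoC 0) - t * l)%C by ring.
    exact Hr. }
  assert (Hz : H (RtoC 0) = 0%C).
  { apply Cmod_eq_0, Rle_antisym; [|apply Cmod_ge_0].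
    apply le_epsilon; intros eps Heps; rewrite Rplus_0_l.
    destruct (Hb (mkposreal 1 Rlt_0_1)) as [r Hr]; cbn [pos] in Hr.
    set (M := 1 + Cmod l).
    assert (HM : 0 < M) by (unfold M; pose proof (Cmod_ge_0 l); lra).
    set (t := Rmin (r / 2) (eps / M)).
    assert (Ht : 0 < t).
    { apply Rmin_glb_lt; [pose proof (cond_pos r); lra|].
      now apply Rdiv_lt_0_compat. }
    assert (Htr : t < r).
    { apply Rle_lt_trans with (1 := Rmin_l _ _).
      pose proof (cond_pos r); lra. }
    assert (HtM : t * M <= eps).
    { replace eps with (eps / M * M) by (field; lra).
      apply Rmult_le_compat_r; [lra|apply Rmin_r]. }
    specialize (Hr t (conj Ht Htr)).
    replace (H (RtoC 0)) with ((H (RtoC 0) + t * l) + - (t * l))%C by ring.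
    apply Rle_trans with (1 := Cmod_triangle _ _).
    rewrite Cmod_opp, Cmod_mult, Cmod_R, (Rabs_pos_eq t) by lra.
    unfold M in HtM; lra. }
  apply Cmod_eq_0, Rle_antisym; [|apply Cmod_ge_0].
  apply le_epsilon; intros eps Heps; rewrite Rplus_0_l.
  destruct (Hb (mkposreal eps Heps)) as [r Hr]; cbn [pos] in Hr.
  pose proof (cond_pos r) as Hrp.
  assert (Ht : 0 < r / 2 < r) by lra.
  specialize (Hr _ Ht); rewrite Hz, Cplus_0_l, Cmod_mult, Cmod_R in Hr.
  rewrite Rabs_pos_eq in Hr by lra; nra. }
replace d with (l + e)%C by (unfold l; ring).
now rewrite Hl, Cplus_0_l.
Qed.

(* Limit of a complex sequence; arbitrary if the sequence diverges. *)
Definition Clim_seq (u : nat -> C) : C :=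
  (real (Lim_seq (fun n => Re (u n))), real (Lim_seq (fun n => Im (u n)))).

Definition mod_gamma (x : C) : C :=
  (/ x * Cexp (x * ln 2) *
   Clim_seq (fun N =>
     Cprod (map (fun m => Calt_pow (Cexp (- (x / INR m)) * (1 + x / INR m)) (S m))
                (seq 1 N))))%C.

(* Main.v *)
Require Import Defs.
From Stdlib Require Import Reals List Lra Lia Arith.
From Coquelicot Require Import Coquelicot.
Import ListNotations.

Open Scope R_scope.

(** With [a = x + i y] and [b = x - i y] both products have the terms
    [(m + a) * (m + b)]; they only differ in the logarithm [L m] of the term that
    is used to form [F s], the sum of the [(-1) ^ m * exp (- s * L m)].  All that
    matters about [L] is the expansion [log_asymp],
    [L m = 2 * ln n + c / n + O(1 / n ^ 2)] with [n = m + 1]; both choices satisfy it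
    because for large [m] the logarithm is taken near the positive real axis
    ([log_asymp_sum_of_logs], [log_asymp_log_of_product]).

    Continuation.  Euler's acceleration replaces an alternating sum of [u] by
    [altreg u], a combination of [u 0], [u 1] and the alternating sum of the second
    differences of [u].  For [u m = exp (- s * L m)] these second differences are
    [O(n ^ (- 2 - 2 * Re s))], so the new series still converges absolutely for [s]
    slightly to the left of the imaginary axis.  Holomorphy is
    proved by summing first-order Taylor expansions with explicit remainders
    ([jet_series]).  The derivative at [0] is [- altreg L], and the regularized
    product is therefore [exp (altreg L)] ([is_zeta_prod_of_logs]).

    Value.  The partial sums defining [altreg L] are the alternating sums of the
    [L m] up to a boundary term of size [ln n].  After exponentiation,
    [exp (altreg L)] is the limit of
    [1 / (2 N + 1) * prod_(m <= 2 N) ((m + a) * (m + b)) ^ ((-1) ^ m)].  Taking out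
    the factors [m], one gets the square of the Wallis product divided by [2 N + 1],
    which tends to [PI / 2] ([wallis_limit]), times the alternating products of
    [1 + a / m] and [1 + b / m].  The latter are those of [mod_gamma] up to the
    exponential of [a], resp. [b], times the alternating harmonic sum, whose limit is
    [ln 2] ([alt_harmonic_even_limit]); hence the factors [exp (a ln 2)] and
    [exp (b ln 2)] of [mod_gamma] ([Cexp_altreg_value]). *)


(** * The complex exponential *)

Lemma Cmod_le_components (z : C) (K : R) :
  Rabs (Re z) <= K -> Rabs (Im z) <= K -> Cmod z <= 2 * K.
Proof.
intros H1 H2.
replace z with ((Re z, 0) + (0, Im z))%C
  by (destruct z; unfold Cplus; simpl; f_equal; ring).
apply Rle_trans with (1 := Cmod_triangle _ _).
assert (E1 : Cmod (Re z, 0) = Rabs (Re z)) by apply Cmod_R.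
assert (E2 : Cmod (0, Im z) = Rabs (Im z)).
{ replace (0, Im z) with (Ci * RtoC (Im z))%C
    by (unfold Cmult, Ci, RtoC; simpl; f_equal; ring).
  rewrite Cmod_mult, Cmod_R, Cmod_Ci; ring. }
lra.
Qed.

Lemma Im_le_Cmod (z : C) : Rabs (Im z) <= Cmod z.
Proof.
apply Rle_trans with (2 := Rmax_Cmod z), Rmax_r.
Qed.

Lemma Cmod_triangle_minus (z w : C) : Cmod (z - w) <= Cmod z + Cmod w.
Proof. unfold Cminus; rewrite <- (Cmod_opp w); apply Cmod_triangle. Qed.

Lemma Cexp_plus (z w : C) : Cexp (z + w) = (Cexp z * Cexp w)%C.
Proof.
destruct z as [a b], w as [c d]; unfold Cexp, Cmult, Cplus; simpl.
rewrite exp_plus, cos_plus, sin_plus; f_equal; ring.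
Qed.

Lemma Cexp_0 : Cexp 0 = 1%C.
Proof. unfold Cexp; simpl; rewrite exp_0, cos_0, sin_0; unfold RtoC; f_equal; ring. Qed.

Lemma Cmod_Cexp (z : C) : Cmod (Cexp z) = exp (Re z).
Proof.
pose proof (exp_pos (Re z)) as He.
unfold Cexp, Cmod; cbn [fst snd].
replace (_ + _) with ((exp (Re z)) ^ 2 * ((sin (Im z))² + (cos (Im z))²))
  by (unfold Rsqr; ring).
rewrite sin2_cos2, Rmult_1_r.
apply sqrt_pow2; lra.
Qed.

Lemma Cexp_neq_0 (z : C) : Cexp z <> 0%C.
Proof. apply Cmod_gt_0; rewrite Cmod_Cexp; apply exp_pos. Qed.

Lemma Cexp_opp (z : C) : Cexp (- z) = (/ Cexp z)%C.
Proof.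
assert (H : (Cexp (- z) * Cexp z = 1)%C).
{ rewrite <- Cexp_plus, <- Cexp_0; f_equal; ring. }
pose proof (Cexp_neq_0 z).
replace (Cexp (- z)) with (Cexp (- z) * Cexp z * / Cexp z)%C by (field; auto).
rewrite H; ring.
Qed.

Lemma Cexp_R (x : R) : Cexp x = RtoC (exp x).
Proof. unfold Cexp, RtoC; simpl; rewrite cos_0, sin_0; f_equal; ring. Qed.

Lemma Cmod_Cexp_le (z : C) : Cmod (Cexp z) <= exp (Cmod z).
Proof.
rewrite Cmod_Cexp.
assert (Re z <= Cmod z) by (eapply Rle_trans; [apply Rle_abs | apply re_le_Cmod]).
destruct H; [left; now apply exp_increasing | rewrite H; lra].
Qed.

Lemma exp_le (x y : R) : x <= y -> exp x <= exp y.
Proof. intros [H | ->]; [left; now apply exp_increasing | lra]. Qed.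

Lemma mean_value_01 (f f' : R -> R) (K : R) :
  (forall c, 0 <= c <= 1 -> is_derive f c (f' c)) ->
  (forall c, 0 <= c <= 1 -> Rabs (f' c) <= K) ->
  Rabs (f 1 - f 0) <= K.
Proof.
intros Hd Hb.
destruct (MVT_cor2 f f' 0 1) as [c [Hc Hc']]; [lra | |].
- intros c Hc; now apply is_derive_Reals, Hd.
- rewrite Hc; replace (f' c * (1 - 0)) with (f' c) by ring.
  apply Hb; lra.
Qed.

Lemma Cmod_Cexp_path (z : C) (c : R) :
  0 <= c <= 1 -> Cmod (Cexp (c * z)) <= exp (Cmod z).
Proof.
intros Hc; apply Rle_trans with (1 := Cmod_Cexp_le _), exp_le.
rewrite Cmod_mult, Cmod_R, Rabs_pos_eq by lra.
pose proof (Cmod_ge_0 z); nra.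
Qed.

(** Both remainder estimates come from the mean value theorem applied to the
    real and imaginary parts of [Cexp] along the segment from [0] to [z]; this
    costs a factor 2 at each order. *)
Lemma Cexp_minus_1_bound (z : C) :
  Cmod (Cexp z - 1) <= 2 * (Cmod z * exp (Cmod z)).
Proof.
assert (HB : forall c, 0 <= c <= 1 ->
  Cmod (z * Cexp (c * z)) <= Cmod z * exp (Cmod z)).
{ intros c Hc; rewrite Cmod_mult; apply Rmult_le_compat_l.
  - apply Cmod_ge_0.
  - now apply Cmod_Cexp_path. }
destruct z as [a b].
apply Cmod_le_components.
- pose proof (mean_value_01 (fun c => exp (c * a) * cos (c * b))
    (fun c => Re ((a, b) * Cexp (c * (a, b)))%C) (Cmod (a, b) * exp (Cmod (a, b))))
    as M.
  cbv beta in M.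
  replace (Re (Cexp (a, b) - 1)) with (exp (1 * a) * cos (1 * b) - exp (0 * a) * cos (0 * b)).
  + apply M; intros c Hc.
    * auto_derive; [easy | simpl].
      replace (c * a - 0 * b) with (c * a) by ring.
      replace (c * b + 0 * a) with (c * b) by ring. ring.
    * apply Rle_trans with (1 := re_le_Cmod _); auto.
  + rewrite !Rmult_0_l, exp_0, cos_0; simpl. rewrite !Rmult_1_l; ring.
- pose proof (mean_value_01 (fun c => exp (c * a) * sin (c * b))
    (fun c => Im ((a, b) * Cexp (c * (a, b)))%C) (Cmod (a, b) * exp (Cmod (a, b))))
    as M.
  cbv beta in M.
  replace (Im (Cexp (a, b) - 1)) with (exp (1 * a) * sin (1 * b) - exp (0 * a) * sin (0 * b)).
  + apply M; intros c Hc.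
    * auto_derive; [easy | simpl].
      replace (c * a - 0 * b) with (c * a) by ring.
      replace (c * b + 0 * a) with (c * b) by ring. ring.
    * apply Rle_trans with (1 := Im_le_Cmod _); auto.
  + rewrite !Rmult_0_l, exp_0, sin_0; simpl. rewrite !Rmult_1_l; ring.
Qed.

Lemma Cexp_taylor1_bound (z : C) :
  Cmod (Cexp z - 1 - z) <= 4 * (Cmod z ^ 2 * exp (Cmod z)).
Proof.
assert (HB : forall c, 0 <= c <= 1 ->
  Cmod (z * (Cexp (c * z) - 1)) <= 2 * (Cmod z ^ 2 * exp (Cmod z))).
{ intros c Hc; rewrite Cmod_mult.
  apply Rle_trans with (Cmod z * (2 * (Cmod (c * z) * exp (Cmod (c * z))))).
  - apply Rmult_le_compat_l; [apply Cmod_ge_0 | apply Cexp_minus_1_bound].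
  - assert (Cmod (c * z) <= Cmod z).
    { rewrite Cmod_mult, Cmod_R, Rabs_pos_eq by lra.
      pose proof (Cmod_ge_0 z); nra. }
    replace (2 * (Cmod z ^ 2 * exp (Cmod z)))
      with (Cmod z * (2 * (Cmod z * exp (Cmod z)))) by ring.
    apply Rmult_le_compat_l; [apply Cmod_ge_0 |].
    apply Rmult_le_compat_l; [lra |].
    apply Rmult_le_compat; auto using Cmod_ge_0, Rlt_le, exp_pos, exp_le. }
replace (4 * (Cmod z ^ 2 * exp (Cmod z))) with (2 * (2 * (Cmod z ^ 2 * exp (Cmod z)))) by ring.
destruct z as [a b].
set (K := 2 * (Cmod (a, b) ^ 2 * exp (Cmod (a, b)))) in *.
apply Cmod_le_components.
- pose proof (mean_value_01 (fun c => exp (c * a) * cos (c * b) - c * a)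
    (fun c => Re ((a, b) * (Cexp (c * (a, b)) - 1))%C) K) as M.
  cbv beta in M.
  replace (Re (Cexp (a, b) - 1 - (a, b)))
    with (exp (1 * a) * cos (1 * b) - 1 * a - (exp (0 * a) * cos (0 * b) - 0 * a)).
  + apply M; intros c Hc.
    * auto_derive; [easy | simpl].
      replace (c * a - 0 * b) with (c * a) by ring.
      replace (c * b + 0 * a) with (c * b) by ring. ring.
    * apply Rle_trans with (1 := re_le_Cmod _); auto.
  + rewrite !Rmult_0_l, exp_0, cos_0; simpl. rewrite !Rmult_1_l; ring.
- pose proof (mean_value_01 (fun c => exp (c * a) * sin (c * b) - c * b)
    (fun c => Im ((a, b) * (Cexp (c * (a, b)) - 1))%C) K) as M.
  cbv beta in M.
  replace (Im (Cexp (a, b) - 1 - (a, b)))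
    with (exp (1 * a) * sin (1 * b) - 1 * b - (exp (0 * a) * sin (0 * b) - 0 * b)).
  + apply M; intros c Hc.
    * auto_derive; [easy | simpl].
      replace (c * a - 0 * b) with (c * a) by ring.
      replace (c * b + 0 * a) with (c * b) by ring. ring.
    * apply Rle_trans with (1 := Im_le_Cmod _); auto.
  + rewrite !Rmult_0_l, exp_0, sin_0; simpl. rewrite !Rmult_1_l; ring.
Qed.

(** * The principal logarithm near 1 *)

Lemma atan_le_Rabs (t : R) : Rabs (atan t) <= Rabs t.
Proof.
pose proof (mean_value_01 (fun c => atan (c * t)) (fun c => t / (1 + (c * t)²)) (Rabs t)) as M.
cbv beta in M.
rewrite Rmult_1_l, Rmult_0_l, atan_0, Rminus_0_r in M; apply M; intros c Hc.
- auto_derive; [easy |]. unfold Rsqr; field. nra.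
- pose proof (Rle_0_sqr (c * t)) as Hs.
  unfold Rdiv; rewrite Rabs_mult, (Rabs_pos_eq (/ _)).
  + assert (/ (1 + (c * t)²) <= 1).
    { rewrite <- Rinv_1; apply Rinv_le_contravar; lra. }
    pose proof (Rabs_pos t); nra.
  + left; apply Rinv_0_lt_compat; lra.
Qed.

(** [Carg] is turned into an arctangent: near [1] the cosine of the argument is
    positive, so the argument lies in [(-PI/2, PI/2)]. *)
Lemma Clog_1_plus_small (z : C) :
  Cmod z <= / 2 -> Cmod (Clog (1 + z)) <= 4 * Cmod z.
Proof.
intros Hz.
pose proof (Cmod_ge_0 z) as Hz0.
pose proof (re_le_Cmod z) as HRe; pose proof (Im_le_Cmod z) as HIm.
apply Rabs_le_between in HRe.
set (w := (1 + z)%C).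
assert (Hw1 : Cmod w <= 1 + Cmod z).
{ unfold w; eapply Rle_trans; [apply Cmod_triangle |]; rewrite Cmod_1; lra. }
assert (Hw2 : 1 - Cmod z <= Cmod w).
{ assert (H : Cmod 1 <= Cmod w + Cmod z).
  { replace (RtoC 1) with (w - z)%C by (unfold w; ring).
    apply Cmod_triangle_minus. }
  rewrite Cmod_1 in H; lra. }
assert (HRw : Re w = 1 + Re z) by (unfold w; destruct z; simpl; ring).
assert (HIw : Im w = Im z) by (unfold w; destruct z; simpl; ring).
assert (Hwn : w <> 0%C) by (apply Cmod_gt_0; lra).
replace (4 * Cmod z) with (2 * (2 * Cmod z)) by ring.
apply Cmod_le_components; unfold Clog; cbn [Re Im fst snd].
- apply Rabs_le; split.
  + replace (Cmod w) with (/ / Cmod w) by (field; lra).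
    rewrite ln_Rinv by (apply Rinv_0_lt_compat; lra).
    apply Ropp_le_contravar.
    apply Rle_trans with (/ Cmod w - 1).
    { pose proof (exp_ineq1_le (ln (/ Cmod w))) as H.
      rewrite exp_ln in H by (apply Rinv_0_lt_compat; lra); lra. }
    apply Rle_trans with (/ (1 - Cmod z) - 1).
    { apply Rplus_le_compat_r, Rinv_le_contravar; lra. }
    apply Rmult_le_reg_r with (1 - Cmod z); [lra |].
    rewrite Rmult_minus_distr_r, Rinv_l by lra; nra.
  + pose proof (exp_ineq1_le (ln (Cmod w))) as H.
    rewrite exp_ln in H by lra; lra.
- pose proof (Carg_bound w Hwn) as Ha.
  pose proof (Cexp_Clog w Hwn) as He.
  set (th := Carg w) in *.
  assert (Hr : 0 < Cmod w) by lra.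
  assert (Hc : Cmod w * cos th = 1 + Re z).
  { rewrite <- HRw; transitivity (Re (Cexp (Clog w))); [| now rewrite He].
  unfold Clog, Cexp; cbn [Re Im fst snd].
    fold th; rewrite exp_ln; [reflexivity | lra]. }
  assert (Hs : Cmod w * sin th = Im z).
  { rewrite <- HIw; transitivity (Im (Cexp (Clog w))); [| now rewrite He].
  unfold Clog, Cexp; cbn [Re Im fst snd].
    fold th; rewrite exp_ln; [reflexivity | lra]. }
  assert (Hcp : 0 < cos th) by nra.
  assert (Hb : - (PI / 2) < th < PI / 2).
  { split; apply Rnot_le_lt; intros Hn.
    - assert (cos (- th) <= 0).
      { apply cos_le_0; lra. }
      rewrite cos_neg in H; lra.
    - assert (cos th <= 0) by (apply cos_le_0; lra). lra. }
  rewrite <- (atan_tan th Hb).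
  apply Rle_trans with (1 := atan_le_Rabs _).
  replace (tan th) with (Im z / (1 + Re z))
    by (unfold tan; rewrite <- Hs, <- Hc; field; lra).
  unfold Rdiv; rewrite Rabs_mult, (Rabs_pos_eq (/ _))
    by (left; apply Rinv_0_lt_compat; lra).
  assert (/ (1 + Re z) <= 2).
  { rewrite <- (Rinv_inv 2); apply Rinv_le_contravar; lra. }
  assert (0 < / (1 + Re z)) by (apply Rinv_0_lt_compat; lra).
  pose proof (Rabs_pos (Im z)); nra.
Qed.

(** With [w := Clog (1 + z)], [w - z] is minus the quadratic remainder of
    [Cexp] at [w], and [w] is [O(z)]. *)
Lemma Clog_1_plus_taylor (z : C) :
  Cmod z <= / 2 -> Cmod (Clog (1 + z) - z) <= 576 * Cmod z ^ 2.
Proof.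
intros Hz.
pose proof (Clog_1_plus_small z Hz) as Hw.
set (w := Clog (1 + z)) in *.
assert (Hwn : (1 + z)%C <> 0%C).
{ apply Cmod_gt_0.
  assert (H : Cmod 1 <= Cmod (1 + z) + Cmod z).
  { replace (RtoC 1) with ((1 + z) - z)%C at 1 by ring.
    apply Cmod_triangle_minus. }
  rewrite Cmod_1 in H; lra. }
assert (He : Cexp w = (1 + z)%C) by now apply Cexp_Clog.
replace (w - z)%C with (- (Cexp w - 1 - w))%C by (rewrite He; ring).
rewrite Cmod_opp.
apply Rle_trans with (1 := Cexp_taylor1_bound w).
pose proof (Cmod_ge_0 w); pose proof (Cmod_ge_0 z).
(* [|w| <= 4 * |z| <= 2], so the constant 4 of the exponential becomes
   [4 * 4 ^ 2 * 9]. *)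
assert (exp (Cmod w) <= 9).
{ apply Rle_trans with (exp (1 + 1)); [apply exp_le; lra |].
  rewrite exp_plus; pose proof exp_le_3; pose proof (exp_pos 1); nra. }
assert (Cmod w ^ 2 <= 16 * Cmod z ^ 2) by nra.
apply Rle_trans with (4 * (16 * Cmod z ^ 2 * 9)); [| lra].
apply Rmult_le_compat_l; [lra |].
apply Rmult_le_compat; auto using Rlt_le, exp_pos; nra.
Qed.

(** * Complex sequences and series *)

(** Convergence is taken componentwise because this is how [Clim_seq] is built,
    and because it reduces the algebra of limits to the real case. *)
Definition Ccv (u : nat -> C) (l : C) : Prop :=
  is_lim_seq (fun n => Re (u n)) (Re l) /\ is_lim_seq (fun n => Im (u n)) (Im l).

Definition csum (a : nat -> C) (n : nat) : C := @sum_n C_AbelianMonoid a n.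

Lemma csum_O (a : nat -> C) : csum a 0 = a 0%nat.
Proof. unfold csum; now rewrite sum_O. Qed.

Lemma csum_S (a : nat -> C) (n : nat) : csum a (S n) = (csum a n + a (S n))%C.
Proof. unfold csum; now rewrite sum_Sn. Qed.

Lemma csum_ext (a b : nat -> C) (n : nat) :
  (forall m, a m = b m) -> csum a n = csum b n.
Proof. intros H; apply sum_n_ext, H. Qed.

Lemma Re_csum (a : nat -> C) (n : nat) : Re (csum a n) = sum_n (fun m => Re (a m)) n.
Proof.
induction n as [|n IH].
- now rewrite csum_O, sum_O.
- rewrite csum_S, sum_Sn, <- IH; reflexivity.
Qed.

Lemma Im_csum (a : nat -> C) (n : nat) : Im (csum a n) = sum_n (fun m => Im (a m)) n.
Proof.
induction n as [|n IH].
- now rewrite csum_O, sum_O.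
- rewrite csum_S, sum_Sn, <- IH; reflexivity.
Qed.

Lemma Ccv_ext (u v : nat -> C) (l : C) :
  (forall n, u n = v n) -> Ccv u l -> Ccv v l.
Proof.
intros E [H1 H2]; split.
- apply is_lim_seq_ext with (2 := H1); intros n; now rewrite E.
- apply is_lim_seq_ext with (2 := H2); intros n; now rewrite E.
Qed.

Lemma Ccv_const (l : C) : Ccv (fun _ => l) l.
Proof. split; apply is_lim_seq_const. Qed.

Lemma Ccv_RtoC (u : nat -> R) (l : R) : is_lim_seq u l -> Ccv (fun n => RtoC (u n)) l.
Proof. intros H; split; [exact H | apply is_lim_seq_const]. Qed.

Lemma Ccv_plus (u v : nat -> C) (l k : C) :
  Ccv u l -> Ccv v k -> Ccv (fun n => u n + v n)%C (l + k)%C.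
Proof.
intros [H1 H2] [H3 H4]; split; cbn [Re Im fst snd Cplus]; now apply is_lim_seq_plus'.
Qed.

Lemma Ccv_mult (u v : nat -> C) (l k : C) :
  Ccv u l -> Ccv v k -> Ccv (fun n => u n * v n)%C (l * k)%C.
Proof.
intros [H1 H2] [H3 H4]; split; cbn [Re Im fst snd Cmult].
- apply is_lim_seq_minus'; now apply is_lim_seq_mult'.
- apply is_lim_seq_plus'; now apply is_lim_seq_mult'.
Qed.

Lemma Ccv_opp (u : nat -> C) (l : C) : Ccv u l -> Ccv (fun n => - u n)%C (- l)%C.
Proof.
intros H; apply Ccv_ext with (fun n => RtoC (-1) * u n)%C; [intros n; ring |].
replace (- l)%C with (RtoC (-1) * l)%C by ring.
apply Ccv_mult; [apply Ccv_const | exact H].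
Qed.

Lemma Ccv_minus (u v : nat -> C) (l k : C) :
  Ccv u l -> Ccv v k -> Ccv (fun n => u n - v n)%C (l - k)%C.
Proof. intros H1 H2; apply Ccv_plus; [exact H1 | now apply Ccv_opp]. Qed.

Lemma Ccv_inv (u : nat -> C) (l : C) :
  l <> 0%C -> Ccv u l -> Ccv (fun n => / u n)%C (/ l)%C.
Proof.
intros Hl [H1 H2].
assert (Hd : fst l ^ 2 + snd l ^ 2 <> 0).
{ intros H; apply Hl; destruct l as [a b]; cbn [fst snd] in H.
  unfold RtoC; f_equal; nra. }
assert (H3 : is_lim_seq (fun n => fst (u n) ^ 2 + snd (u n) ^ 2) (fst l ^ 2 + snd l ^ 2)).
{ apply is_lim_seq_plus'; simpl;
  repeat apply is_lim_seq_mult'; auto using is_lim_seq_const. }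
split; unfold Cinv; cbn [Re Im fst snd].
- apply is_lim_seq_div'; auto.
- apply is_lim_seq_div'; auto. now apply (is_lim_seq_opp _ (Im l)).
Qed.

Lemma Ccv_Cexp (u : nat -> C) (l : C) : Ccv u l -> Ccv (fun n => Cexp (u n)) (Cexp l).
Proof.
intros [H1 H2]; split; unfold Cexp; cbn [Re Im fst snd]; apply is_lim_seq_mult'.
- now apply is_lim_seq_continuous; [apply derivable_continuous, derivable_exp |].
- now apply is_lim_seq_continuous; [apply continuity_cos |].
- now apply is_lim_seq_continuous; [apply derivable_continuous, derivable_exp |].
- now apply is_lim_seq_continuous; [apply continuity_sin |].
Qed.

Lemma Ccv_subseq (u : nat -> C) (l : C) (phi : nat -> nat) :
  filterlim phi eventually eventually -> Ccv u l -> Ccv (fun n => u (phi n)) l.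
Proof.
intros Hp [H1 H2]; split.
- exact (is_lim_seq_subseq (fun n => Re (u n)) _ phi Hp H1).
- exact (is_lim_seq_subseq (fun n => Im (u n)) _ phi Hp H2).
Qed.

Lemma Ccv_unique (u : nat -> C) (l k : C) : Ccv u l -> Ccv u k -> l = k.
Proof.
intros [H1 H2] [H3 H4].
apply is_lim_seq_unique in H1; apply is_lim_seq_unique in H2.
apply is_lim_seq_unique in H3; apply is_lim_seq_unique in H4.
rewrite H1 in H3; rewrite H2 in H4.
injection H3 as E1; injection H4 as E2.
destruct l, k; unfold Re, Im in E1, E2; cbn [fst snd] in E1, E2.
now subst.
Qed.

Lemma Ccv_Clim_seq (u : nat -> C) (l : C) : Ccv u l -> Clim_seq u = l.
Proof.
intros [H1 H2]; unfold Clim_seq.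
rewrite (is_lim_seq_unique _ _ H1), (is_lim_seq_unique _ _ H2).
now destruct l.
Qed.

Lemma Ccv_bounded_by (u : nat -> C) (l : C) (e : nat -> R) :
  (forall n, Cmod (u n - l) <= e n) -> is_lim_seq e 0 -> Ccv u l.
Proof.
intros Hb He.
assert (Hm : is_lim_seq (fun n => - e n) 0).
{ replace (Finite 0) with (Rbar_opp 0) by (simpl; f_equal; ring).
  exact (proj1 (is_lim_seq_opp _ _) He). }
assert (K : forall (v : nat -> R) (x : R),
  (forall n, Rabs (v n - x) <= e n) -> is_lim_seq v x).
{ intros v x Hv.
  apply is_lim_seq_ext with (fun n => (v n - x) + x); [intros n; ring |].
  replace (Finite x) with (Finite (0 + x)) by (f_equal; ring).
  apply is_lim_seq_plus'; [| apply is_lim_seq_const].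
  apply is_lim_seq_le_le with (2 := Hm) (3 := He).
  intros n; apply Rabs_le_between, Hv. }
split; apply K; intros n.
- apply Rle_trans with (2 := Hb n), (re_le_Cmod (u n - l)%C).
- apply Rle_trans with (2 := Hb n), (Im_le_Cmod (u n - l)%C).
Qed.

Lemma Ccv_0 (u : nat -> C) (e : nat -> R) :
  (forall n, Cmod (u n) <= e n) -> is_lim_seq e 0 -> Ccv u 0%C.
Proof.
intros H He; apply Ccv_bounded_by with e; [| exact He].
intros n; replace (u n - 0)%C with (u n) by ring; apply H.
Qed.

Lemma Ccv_Cmod_0 (u : nat -> C) : Ccv u 0%C -> is_lim_seq (fun n => Cmod (u n)) 0.
Proof.
intros [H1 H2].
apply is_lim_seq_le_le with (fun _ => 0) (fun n => 2 * (Rabs (Re (u n)) + Rabs (Im (u n)))).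
- intros n; split; [apply Cmod_ge_0 |].
  pose proof (Rabs_pos (Re (u n))); pose proof (Rabs_pos (Im (u n))).
  apply Cmod_le_components; lra.
- apply is_lim_seq_const.
- replace (Finite 0) with (Finite (2 * (0 + 0))) by (f_equal; ring).
  apply is_lim_seq_mult'; [apply is_lim_seq_const |].
  apply is_lim_seq_plus'; apply is_lim_seq_abs_0 in H1; apply is_lim_seq_abs_0 in H2; assumption.
Qed.

Lemma is_series_of_Ccv (a : nat -> C) (l : C) :
  Ccv (csum a) l -> is_series (V := C_NormedModule) a l.
Proof.
intros [H1 H2].
apply is_lim_seq_spec in H1; apply is_lim_seq_spec in H2.
intros P [eps HP].
destruct (H1 eps) as [N1 HN1]; destruct (H2 eps) as [N2 HN2].
exists (max N1 N2); intros n Hn; apply HP; split.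
- apply (HN1 n); lia.
- apply (HN2 n); lia.
Qed.

Definition CSeries (a : nat -> C) : C :=
  (Series (fun n => Re (a n)), Series (fun n => Im (a n))).

Lemma CSeries_bound (a : nat -> C) (b : nat -> R) :
  (forall n, Cmod (a n) <= b n) -> ex_series b ->
  Ccv (csum a) (CSeries a) /\ Cmod (CSeries a) <= 2 * Series b.
Proof.
intros Hb Hs.
assert (K : forall v : nat -> R, (forall n, Rabs (v n) <= b n) ->
  is_lim_seq (sum_n v) (Series v) /\ Rabs (Series v) <= Series b).
{ intros v Hv.
  assert (Hex : ex_series (fun n => Rabs (v n))).
  { apply (ex_series_le (V := R_CompleteNormedModule)) with (2 := Hs).
    intros n; change (Rabs (Rabs (v n)) <= b n); rewrite Rabs_Rabsolu; apply Hv. }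
  split.
  - apply Series_correct, ex_series_Rabs, Hex.
  - apply Rle_trans with (1 := Series_Rabs v Hex).
    apply Series_le; [| exact Hs].
    intros n; split; [apply Rabs_pos | apply Hv]. }
destruct (K (fun n => Re (a n))) as [L1 B1].
{ intros n; apply Rle_trans with (2 := Hb n), re_le_Cmod. }
destruct (K (fun n => Im (a n))) as [L2 B2].
{ intros n; apply Rle_trans with (2 := Hb n), Im_le_Cmod. }
split; [split |].
- apply is_lim_seq_ext with (2 := L1); intros n; now rewrite Re_csum.
- apply is_lim_seq_ext with (2 := L2); intros n; now rewrite Im_csum.
- now apply Cmod_le_components.
Qed.

Lemma CSeries_unique (a : nat -> C) (l : C) : Ccv (csum a) l -> CSeries a = l.
Proof.
intros [H1 H2]; destruct l as [x y]; unfold CSeries; f_equal; apply is_series_unique.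
- apply is_lim_seq_ext with (2 := H1); intros n; apply Re_csum.
- apply is_lim_seq_ext with (2 := H2); intros n; apply Im_csum.
Qed.

Lemma csum_plus (a b : nat -> C) (n : nat) :
  csum (fun m => a m + b m)%C n = (csum a n + csum b n)%C.
Proof.
induction n as [|n IH]; [now rewrite !csum_O | rewrite !csum_S, IH; ring].
Qed.

Lemma csum_scal (c : C) (a : nat -> C) (n : nat) :
  csum (fun m => c * a m)%C n = (c * csum a n)%C.
Proof.
induction n as [|n IH]; [now rewrite !csum_O | rewrite !csum_S, IH; ring].
Qed.

(** * First-order expansions with explicit remainder *)

(** A quantitative form of differentiability at [t].  Unlike differentiability, it is
    inherited by sums of series as soon as the constants [K] are summable, so
    holomorphy of a series is obtained without Cauchy's integral formula. *)
Definition jet (t : C) (r : R) (f : C -> C) (d : C) (K : R) : Prop :=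
  Cmod (f t) <= K /\ Cmod d <= K /\
  forall s, Cmod (s - t) <= r ->
    Cmod (f s - f t - (s - t) * d) <= K * Cmod (s - t) ^ 2.

Lemma jet_bound_nonneg t r f d K : jet t r f d K -> 0 <= K.
Proof. intros [H _]; apply Rle_trans with (1 := Cmod_ge_0 _) (2 := H). Qed.

Lemma jet_weaken t r f d K K' : K <= K' -> jet t r f d K -> jet t r f d K'.
Proof.
intros HK [H1 [H2 H3]]; repeat split; try lra.
intros s Hs; apply Rle_trans with (1 := H3 s Hs).
apply Rmult_le_compat_r; [apply pow2_ge_0 | exact HK].
Qed.

Lemma jet_ext t r f g d e K :
  (forall s, f s = g s) -> d = e -> jet t r f d K -> jet t r g e K.
Proof.
intros E <- [H1 [H2 H3]]; repeat split; auto.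
- now rewrite <- E.
- intros s; rewrite <- !E; apply H3.
Qed.

Lemma jet_scal t r c f d K :
  jet t r f d K -> jet t r (fun s => c * f s)%C (c * d)%C (Cmod c * K).
Proof.
intros [H1 [H2 H3]]; pose proof (Cmod_ge_0 c); repeat split.
- rewrite Cmod_mult; now apply Rmult_le_compat_l.
- rewrite Cmod_mult; now apply Rmult_le_compat_l.
- intros s Hs; replace (c * f s - c * f t - (s - t) * (c * d))%C
    with (c * (f s - f t - (s - t) * d))%C by ring.
  rewrite Cmod_mult, Rmult_assoc; apply Rmult_le_compat_l; auto.
Qed.

Lemma jet_plus t r f g d e K M :
  jet t r f d K -> jet t r g e M -> jet t r (fun s => f s + g s)%C (d + e)%C (K + M).
Proof.
intros [H1 [H2 H3]] [H4 [H5 H6]]; repeat split.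
- apply Rle_trans with (1 := Cmod_triangle _ _); lra.
- apply Rle_trans with (1 := Cmod_triangle _ _); lra.
- intros s Hs.
  replace (f s + g s - (f t + g t) - (s - t) * (d + e))%C
    with ((f s - f t - (s - t) * d) + (g s - g t - (s - t) * e))%C by ring.
  apply Rle_trans with (1 := Cmod_triangle _ _).
  specialize (H3 s Hs); specialize (H6 s Hs); lra.
Qed.

(** The product remainder consists of six terms, each at most [K * M * h ^ 2]
    because [|h| <= r <= 1]. *)
Lemma jet_mult t r f g d e K M : r <= 1 ->
  jet t r f d K -> jet t r g e M ->
  jet t r (fun s => f s * g s)%C (d * g t + f t * e)%C (6 * (K * M)).
Proof.
intros Hr Hf Hg.
assert (HK := jet_bound_nonneg _ _ _ _ _ Hf).
assert (HM := jet_bound_nonneg _ _ _ _ _ Hg).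
destruct Hf as [H1 [H2 H3]], Hg as [H4 [H5 H6]].
assert (P : forall x y : C, forall X Y, Cmod x <= X -> Cmod y <= Y -> Cmod (x * y) <= X * Y).
{ intros x y X Y Hx Hy; rewrite Cmod_mult.
  apply Rmult_le_compat; auto using Cmod_ge_0. }
assert (HKM : 0 <= K * M) by now apply Rmult_le_pos.
repeat split.
- apply Rle_trans with (K * M); [now apply P | lra].
- apply Rle_trans with (1 := Cmod_triangle _ _).
  pose proof (P _ _ _ _ H2 H4); pose proof (P _ _ _ _ H1 H5); lra.
- intros s Hs.
  specialize (H3 s Hs); specialize (H6 s Hs).
  set (h := (s - t)%C) in *.
  set (D := Cmod h) in *.
  set (u := (f s - f t - h * d)%C) in *.
  set (v := (g s - g t - h * e)%C) in *.
  assert (HD : 0 <= D <= 1) by (split; [apply Cmod_ge_0 | lra]).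
  replace (f s * g s - f t * g t - h * (d * g t + f t * e))%C
    with (u * g t + f t * v + ((h * d) * (h * e) + u * (h * e) + (h * d) * v + u * v))%C
    by (unfold u, v; ring).
  assert (Hd : Cmod (h * d) <= D * K) by (apply P; [apply Rle_refl | exact H2]).
  assert (He : Cmod (h * e) <= D * M) by (apply P; [apply Rle_refl | exact H5]).
  pose proof (P _ _ _ _ H3 H4); pose proof (P _ _ _ _ H1 H6).
  pose proof (P _ _ _ _ Hd He); pose proof (P _ _ _ _ H3 He).
  pose proof (P _ _ _ _ Hd H6); pose proof (P _ _ _ _ H3 H6).
  repeat (eapply Rle_trans; [apply Cmod_triangle |]).
  assert (A : Cmod (u * g t + f t * v) <= 2 * (K * M) * D ^ 2).
  { apply Rle_trans with (1 := Cmod_triangle _ _); nra. }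
  assert (B : Cmod (h * d * (h * e) + u * (h * e) + h * d * v + u * v) <= 4 * (K * M) * D ^ 2).
  { apply Rle_trans with (D * K * (D * M) + K * D ^ 2 * (D * M)
      + D * K * (M * D ^ 2) + K * D ^ 2 * (M * D ^ 2)).
    - repeat (eapply Rle_trans; [apply Cmod_triangle |]; apply Rplus_le_compat; [| assumption]).
      assumption.
    - assert (D ^ 3 <= D ^ 2) by (simpl; nra).
      assert (D ^ 4 <= D ^ 2) by (simpl; nra).
      nra. }
  lra.
Qed.

Lemma jet_const t r c : jet t r (fun _ => c) 0%C (Cmod c).
Proof.
repeat split.
- apply Rle_refl.
- rewrite Cmod_0; apply Cmod_ge_0.
- intros s _; replace (c - c - (s - t) * 0)%C with (RtoC 0) by ring.
  rewrite Cmod_0; apply Rmult_le_pos; [apply Cmod_ge_0 | apply pow2_ge_0].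
Qed.

(** The remainder of the sum is the sum of the remainders; the factor 2 is that of
    [CSeries_bound]. *)
Lemma jet_series t r (f : nat -> C -> C) (d : nat -> C) (K : nat -> R) : 0 <= r ->
  (forall m, jet t r (f m) (d m) (K m)) -> ex_series K ->
  jet t r (fun s => CSeries (fun m => f m s)) (CSeries d) (2 * Series K).
Proof.
intros Hr Hj HK.
destruct (CSeries_bound (fun m => f m t) K (fun m => proj1 (Hj m)) HK) as [Cf Bf].
destruct (CSeries_bound d K (fun m => proj1 (proj2 (Hj m))) HK) as [Cd Bd].
repeat split; auto.
intros s Hs.
assert (HKs : ex_series (fun m => Cmod (s - t) ^ 2 * K m))
  by now apply (ex_series_scal_l (Cmod (s - t) ^ 2) K).
destruct (CSeries_bound (fun m => f m s - f m t - (s - t) * d m)%C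
  (fun m => Cmod (s - t) ^ 2 * K m)) as [Ce Be]; auto.
{ intros m; rewrite Rmult_comm; now apply Hj. }
rewrite Series_scal_l in Be.
replace (CSeries (fun m => f m s) - CSeries (fun m => f m t) - (s - t) * CSeries d)%C
  with (CSeries (fun m => f m s - f m t - (s - t) * d m)%C); [lra |].
set (E := CSeries (fun m => f m s - f m t - (s - t) * d m)%C) in *.
assert (Cs : CSeries (fun m => f m s) = (E + (CSeries (fun m => f m t) + (s - t) * CSeries d))%C).
{ apply CSeries_unique.
  apply Ccv_ext with (fun n => csum (fun m => f m s - f m t - (s - t) * d m)%C n
    + (csum (fun m => f m t) n + (s - t) * csum d n))%C.
  - intros n; rewrite <- csum_scal, <- !csum_plus.
    apply csum_ext; intros m; ring.
  - apply Ccv_plus; auto. apply Ccv_plus; auto. apply Ccv_mult; auto using Ccv_const. }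
rewrite Cs; ring.
Qed.

Lemma jet_is_derive t r f d K : 0 < r -> jet t r f d K ->
  is_derive (K := C_AbsRing) (V := C_NormedModule) f t d.
Proof.
intros Hr Hj.
assert (HK := jet_bound_nonneg _ _ _ _ _ Hj).
destruct Hj as [_ [_ H3]].
split; [apply is_linear_scal_l |].
intros x Hx.
assert (E : t = x).
{ exact (is_filter_lim_locally_unique (V := AbsRing_NormedModule C_AbsRing) _ _ Hx). }
subst x; intros eps.
(* [K + 1] rather than [K], which may vanish. *)
assert (Hq : 0 < Rmin r (eps / (K + 1))).
{ apply Rmin_glb_lt; [exact Hr | apply Rdiv_lt_0_compat; [apply cond_pos | lra]]. }
exists (mkposreal _ Hq); intros s Hs.
change (Cmod (s - t)%C < Rmin r (eps / (K + 1))) in Hs.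
change (Cmod (f s - f t - (s - t) * d)%C <= eps * Cmod (s - t)%C).
assert (Hs1 : Cmod (s - t)%C <= r) by (pose proof (Rmin_l r (eps / (K + 1))); lra).
assert (Hs2 : Cmod (s - t)%C <= eps / (K + 1)) by (pose proof (Rmin_r r (eps / (K + 1))); lra).
apply Rle_trans with (1 := H3 s Hs1).
replace (K * Cmod (s - t) ^ 2) with ((K * Cmod (s - t)) * Cmod (s - t)) by ring.
apply Rmult_le_compat_r; [apply Cmod_ge_0 |].
apply Rle_trans with ((K + 1) * (eps / (K + 1))); [| right; field; lra].
pose proof (Cmod_ge_0 (s - t)%C).
apply Rmult_le_compat; lra.
Qed.

Lemma jet_Cexp_remainder (t s w : C) (r : R) :
  Cmod (s - t) <= r ->
  Cmod (Cexp (- s * w) - Cexp (- t * w) - (s - t) * (- w * Cexp (- t * w))) <=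
  Cmod (Cexp (- t * w)) * (4 * Cmod w ^ 2) * exp (r * Cmod w) * Cmod (s - t) ^ 2.
Proof.
intros Hs.
set (h := (- (s - t) * w)%C).
replace (Cexp (- s * w)) with (Cexp (- t * w) * Cexp h)%C
  by (rewrite <- Cexp_plus; f_equal; unfold h; ring).
replace (Cexp (- t * w) * Cexp h - Cexp (- t * w) - (s - t) * (- w * Cexp (- t * w)))%C
  with (Cexp (- t * w) * (Cexp h - 1 - h))%C by (unfold h; ring).
rewrite Cmod_mult, !Rmult_assoc; apply Rmult_le_compat_l; [apply Cmod_ge_0 |].
apply Rle_trans with (1 := Cexp_taylor1_bound h).
assert (Eh : Cmod h = Cmod (s - t) * Cmod w) by (unfold h; now rewrite Cmod_mult, Cmod_opp).
rewrite Eh, Rpow_mult_distr.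
pose proof (Cmod_ge_0 w); pose proof (Cmod_ge_0 (s - t)%C).
assert (exp (Cmod (s - t) * Cmod w) <= exp (r * Cmod w)) by (apply exp_le; nra).
replace (4 * (Cmod w ^ 2 * (exp (r * Cmod w) * Cmod (s - t) ^ 2)))
  with (4 * (Cmod (s - t) ^ 2 * Cmod w ^ 2 * exp (r * Cmod w))) by ring.
apply Rmult_le_compat_l; [lra |].
apply Rmult_le_compat_l; [apply Rmult_le_pos; apply pow2_ge_0 | assumption].
Qed.

Definition jet_Cexp_bound (t : C) (r : R) (w : C) : R :=
  Cmod (Cexp (- t * w)) * (1 + Cmod w + 4 * Cmod w ^ 2) * exp (r * Cmod w).

Lemma jet_Cexp (t : C) (r : R) (w : C) : 0 <= r ->
  jet t r (fun s => Cexp (- s * w)) (- w * Cexp (- t * w))%C (jet_Cexp_bound t r w).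
Proof.
intros Hr; unfold jet_Cexp_bound.
set (E := Cmod (Cexp (- t * w))).
assert (HE : 0 <= E) by apply Cmod_ge_0.
pose proof (Cmod_ge_0 w) as Hw.
set (x := Cmod w) in *.
assert (He : 1 <= exp (r * x)).
{ rewrite <- exp_0; apply exp_le; nra. }
assert (G : forall y, 0 <= y <= 1 + x + 4 * x ^ 2 ->
  E * y <= E * (1 + x + 4 * x ^ 2) * exp (r * x)).
{ intros y Hy; rewrite Rmult_assoc; apply Rmult_le_compat_l; [exact HE | nra]. }
repeat split.
- fold E. replace E with (E * 1) at 1 by ring. apply G; nra.
- rewrite Cmod_mult, Cmod_opp; fold E x; rewrite Rmult_comm; apply G; nra.
- intros s Hs; apply Rle_trans with (1 := jet_Cexp_remainder t s w r Hs).
  fold E x.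
  apply Rmult_le_compat_r; [apply pow2_ge_0 |].
  apply Rmult_le_compat_r; [lra |].
  apply Rmult_le_compat_l; nra.
Qed.

(** Contrary to [jet_Cexp], the constant is proportional to [Cmod w]: this is where
    the decay of the differences of logarithms enters. *)
Lemma jet_Cexp_minus_1 (t : C) (r P : R) (w : C) : 0 <= r <= 1 -> Cmod w <= P ->
  jet t r (fun s => Cexp (- s * w) - 1)%C (- w * Cexp (- t * w))%C
    (exp (Cmod t * P) * (2 * Cmod t + 1 + 4 * P) * exp P * Cmod w).
Proof.
intros Hr HP.
pose proof (Cmod_ge_0 w) as Hw; pose proof (Cmod_ge_0 t) as Ht.
set (x := Cmod w) in *.
assert (HE : Cmod (Cexp (- t * w)) <= exp (Cmod t * P)).
{ apply Rle_trans with (1 := Cmod_Cexp_le _), exp_le.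
  rewrite Cmod_mult, Cmod_opp; fold x; nra. }
pose proof (exp_pos (Cmod t * P)) as HEp.
assert (HeP : 1 <= exp P) by (rewrite <- exp_0; apply exp_le; lra).
set (E := exp (Cmod t * P)) in *.
assert (G : forall y, 0 <= y <= 2 * Cmod t + 1 + 4 * P ->
  E * y * x <= E * (2 * Cmod t + 1 + 4 * P) * exp P * x).
{ intros y Hy; apply Rmult_le_compat_r; [exact Hw |].
  rewrite Rmult_assoc; apply Rmult_le_compat_l; [lra | nra]. }
repeat split.
- apply Rle_trans with (1 := Cexp_minus_1_bound _).
  rewrite Cmod_mult, Cmod_opp; fold x.
  apply Rle_trans with (E * (2 * Cmod t) * x); [| apply G; lra].
  assert (exp (Cmod t * x) <= E) by (apply exp_le; nra).
  replace (E * (2 * Cmod t) * x) with (2 * (Cmod t * x * E)) by ring.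
  apply Rmult_le_compat_l; [lra |]; apply Rmult_le_compat_l; [nra | assumption].
- rewrite Cmod_mult, Cmod_opp; fold x.
  apply Rle_trans with (E * 1 * x); [nra | apply G; lra].
- intros s Hs.
  replace (Cexp (- s * w) - 1 - (Cexp (- t * w) - 1))%C
    with (Cexp (- s * w) - Cexp (- t * w))%C by ring.
  apply Rle_trans with (1 := jet_Cexp_remainder t s w r Hs); fold x.
  apply Rmult_le_compat_r; [apply pow2_ge_0 |].
  assert (exp (r * x) <= exp P) by (apply exp_le; nra).
  apply Rle_trans with (E * (4 * x ^ 2) * exp P).
  + apply Rmult_le_compat; auto using Rlt_le, exp_pos.
    * apply Rmult_le_pos; [apply Cmod_ge_0 | nra].
    * apply Rmult_le_compat_r; [nra | exact HE].
  + replace (E * (4 * x ^ 2) * exp P) with (E * exp P * x * (4 * x)) by ring.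
    replace (E * (2 * Cmod t + 1 + 4 * P) * exp P * x)
      with (E * exp P * x * (2 * Cmod t + 1 + 4 * P)) by ring.
    apply Rmult_le_compat_l; [| lra].
    repeat apply Rmult_le_pos; lra.
Qed.

(** With [p = w1 - w0] and [q = w0 - 2 * w1 + w2], the second difference of
    [exp (- s w)] factors as
    [exp (- s w0) * ((exp (- s p) - 1) ^ 2 + exp (- s p) ^ 2 * (exp (- s q) - 1))],
    which is small of second order when [p] is of first and [q] of second order. *)
Lemma jet_second_difference (t : C) (r P : R) : 0 <= r <= 1 -> 0 <= P ->
  exists M, 0 <= M /\ forall (w0 w1 w2 : C) (rho : R), 0 <= rho <= 1 ->
  Cmod (w1 - w0) <= P * rho -> Cmod (w0 - 2 * w1 + w2) <= P * rho ^ 2 ->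
  jet t r (fun s => Cexp (- s * w0) - 2 * Cexp (- s * w1) + Cexp (- s * w2))%C
    (- w0 * Cexp (- t * w0) - 2 * (- w1 * Cexp (- t * w1)) + - w2 * Cexp (- t * w2))%C
    (M * rho ^ 2 * jet_Cexp_bound t r w0).
Proof.
intros Hr HP.
set (A := exp (Cmod t * P) * (2 * Cmod t + 1 + 4 * P) * exp P).
assert (HA : 0 <= A).
{ pose proof (Cmod_ge_0 t); unfold A.
  repeat apply Rmult_le_pos; auto using Rlt_le, exp_pos; lra. }
set (M := 6 * (6 * (A * P * (A * P)) + 6 * (6 * ((A * P + 1) * (A * P + 1)) * (A * P)))).
assert (HAP : 0 <= A * P) by now apply Rmult_le_pos.
exists M; split; [unfold M; nra |].
intros w0 w1 w2 rho Hrho Hp Hq.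
set (p := (w1 - w0)%C) in *.
set (q := (w0 - 2 * w1 + w2)%C) in *.
assert (Hr2 : 0 <= rho ^ 2 <= 1) by nra.
assert (JX : jet t r (fun s => Cexp (- s * p) - 1)%C (- p * Cexp (- t * p))%C (A * P * rho)).
{ eapply jet_weaken; [| apply jet_Cexp_minus_1 with (P := P); [exact Hr | nra]].
  fold A; rewrite Rmult_assoc; apply Rmult_le_compat_l; assumption. }
assert (JY : jet t r (fun s => Cexp (- s * q) - 1)%C (- q * Cexp (- t * q))%C (A * P * rho ^ 2)).
{ eapply jet_weaken; [| apply jet_Cexp_minus_1 with (P := P); [exact Hr | nra]].
  fold A; rewrite Rmult_assoc; apply Rmult_le_compat_l; assumption. }
assert (JX1 := jet_plus _ _ _ _ _ _ _ _ JX (jet_const t r 1%C)).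
rewrite Cmod_1 in JX1.
apply (jet_weaken _ _ _ _ _ (A * P + 1)) in JX1; [| nra].
assert (Hr1 : r <= 1) by lra.
assert (J1 := jet_mult _ _ _ _ _ _ _ _ Hr1 JX JX).
assert (J2 := jet_mult _ _ _ _ _ _ _ _ Hr1 (jet_mult _ _ _ _ _ _ _ _ Hr1 JX1 JX1) JY).
assert (J := jet_mult _ _ _ _ _ _ _ _ Hr1 (jet_Cexp t r w0 (proj1 Hr))
  (jet_plus _ _ _ _ _ _ _ _ J1 J2)).
apply (jet_weaken _ _ _ _ _ (M * rho ^ 2 * jet_Cexp_bound t r w0)) in J;
  [| right; unfold M; ring].
assert (E1 : forall s, Cexp (- s * w1) = (Cexp (- s * w0) * Cexp (- s * p))%C).
{ intros s; rewrite <- Cexp_plus; f_equal; unfold p; ring. }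
assert (E2 : forall s, Cexp (- s * w2) =
  (Cexp (- s * w0) * (Cexp (- s * p) * (Cexp (- s * p) * Cexp (- s * q))))%C).
{ intros s; rewrite <- !Cexp_plus; f_equal; unfold p, q; ring. }
apply jet_ext with (3 := J).
- intros s; cbv beta; rewrite E1, E2; ring.
- rewrite (E1 t), (E2 t).
  replace (- w1)%C with (- (w0 + p))%C by (unfold p; ring).
  replace (- w2)%C with (- (w0 + p + p + q))%C by (unfold p, q; ring).
  ring.
Qed.

(** * A convergent majorant *)

Lemma ex_series_telescope (v : nat -> R) :
  is_lim_seq v 0 -> ex_series (fun m => v m - v (S m)).
Proof.
intros Hv; exists (v 0%nat - 0).
change (is_lim_seq (sum_n (fun m => v m - v (S m))) (v 0%nat - 0)).
apply (is_lim_seq_ext (fun n => v 0%nat - v (S n))).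
- intros n; symmetry; induction n as [|n IH].
  + now rewrite sum_O.
  + rewrite sum_Sn, IH; unfold plus; simpl; ring.
- apply is_lim_seq_minus'; [apply is_lim_seq_const |].
  now apply is_lim_seq_incr_1 in Hv.
Qed.

Lemma is_lim_seq_inv_INR_S : is_lim_seq (fun n => / INR (S n)) 0.
Proof.
replace (Finite 0) with (Rbar_inv p_infty) by reflexivity.
apply is_lim_seq_inv; [| easy].
apply (is_lim_seq_incr_1 INR), is_lim_seq_INR.
Qed.

(** The general term is [n ^ (- 3 / 2)] with [n = m + 1]; it is compared with
    [6 * (1 / sqrt n - 1 / sqrt (n + 1))], whose sum telescopes. *)
Lemma ex_series_sqrt_div_sq :
  ex_series (fun m => (/ INR (S m)) ^ 2 * sqrt (INR (S m))).
Proof.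
set (v := fun m => sqrt (/ INR (S m))).
assert (Hv : is_lim_seq v 0).
{ replace (Finite 0) with (Finite (sqrt 0)) by (now rewrite sqrt_0).
  apply is_lim_seq_continuous; [apply continuity_pt_sqrt; lra |].
  apply is_lim_seq_inv_INR_S. }
apply (ex_series_le (V := R_CompleteNormedModule)) with (fun m => 6 * (v m - v (S m))).
2: { apply (ex_series_scal_l 6 (fun m => v m - v (S m))), ex_series_telescope, Hv. }
intros m.
change (Rabs ((/ INR (S m)) ^ 2 * sqrt (INR (S m))) <= 6 * (v m - v (S m))).
assert (Hn : 1 <= INR (S m)) by (rewrite S_INR; pose proof (pos_INR m); lra).
unfold v; rewrite (S_INR (S m)); set (n := INR (S m)) in *.
rewrite !sqrt_inv.
assert (Hx := sqrt_sqrt n ltac:(lra)); assert (Hy := sqrt_sqrt (n + 1) ltac:(lra)).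
assert (Hx0 := sqrt_pos n); assert (Hy0 := sqrt_pos (n + 1)).
set (x := sqrt n) in *; set (y := sqrt (n + 1)) in *.
assert (1 <= x) by nra.
assert (x < y) by nra. assert (y <= 2 * x) by nra.
rewrite Rabs_pos_eq by (apply Rmult_le_pos; [apply pow2_ge_0 | lra]).
replace ((/ n) ^ 2 * x) with (/ (x * x * x)) by (rewrite <- Hx; field; lra).
replace (/ x - / y) with (/ (x * y * (x + y))).
2: { transitivity ((y - x) * (y + x) / (x * y * (x + y))); [| field; lra].
  replace ((y - x) * (y + x)) with 1 by nra; unfold Rdiv; ring. }
replace (/ (x * x * x)) with (6 * / (6 * (x * x * x))) by (field; lra).
apply Rmult_le_compat_l; [lra |].
apply Rinv_le_contravar; [repeat apply Rmult_lt_0_compat; lra |].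
replace (6 * (x * x * x)) with (x * (2 * x) * (3 * x)) by ring.
apply Rmult_le_compat; try nra.
Qed.

(** * Sequences of logarithms *)

Lemma INR_S_ge_1 (m : nat) : 1 <= INR (S m).
Proof. rewrite S_INR; pose proof (pos_INR m); lra. Qed.

Lemma inv_INR_S_bounds (m : nat) : 0 < / INR (S m) <= 1.
Proof.
assert (H := INR_S_ge_1 m).
split; [apply Rinv_0_lt_compat; lra |].
rewrite <- Rinv_1; apply Rinv_le_contravar; lra.
Qed.

(** The expansion of a logarithm of [(m + a) * (m + b)], written in powers of
    [1 / (m + 1)] so that it makes sense from [m = 0] on.  It rules out jumps by
    multiples of [2 * PI * i] for large [m], while any choice of logarithm is
    allowed for small [m]. *)
Definition log_asymp (c : C) (L : nat -> C) : Prop :=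
  exists K : R, forall m,
    Cmod (L m - (RtoC (2 * ln (INR (S m))) + c * RtoC (/ INR (S m)))) <=
    K * (/ INR (S m)) ^ 2.

Lemma ln_upper (x : R) : 0 < x -> ln x <= x - 1.
Proof.
intros Hx; pose proof (exp_ineq1_le (ln x)) as H; rewrite exp_ln in H; lra.
Qed.

Lemma ln_lower (x : R) : 0 < x -> 1 - / x <= ln x.
Proof.
intros Hx; assert (H := ln_upper (/ x) (Rinv_0_lt_compat _ Hx)).
rewrite ln_Rinv in H; lra.
Qed.

Lemma ln_first_difference (n : R) : 1 <= n -> Rabs (ln (n + 1) - ln n) <= / n.
Proof.
intros Hn.
assert (Hi : 0 < / n) by (apply Rinv_0_lt_compat; lra).
rewrite <- ln_div by lra.
replace ((n + 1) / n) with (1 + / n) by (field; lra).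
assert (H1 := ln_upper (1 + / n) ltac:(lra)).
assert (H2 := ln_lower (1 + / n) ltac:(lra)).
assert (/ (1 + / n) <= 1) by (rewrite <- Rinv_1; apply Rinv_le_contravar; lra).
apply Rabs_le; lra.
Qed.

Lemma ln_second_difference (n : R) : 1 <= n ->
  Rabs (ln n - 2 * ln (n + 1) + ln (n + 2)) <= (/ n) ^ 2.
Proof.
intros Hn.
set (x := n * (n + 2) / ((n + 1) * (n + 1))).
assert (Hx : 0 < x).
{ apply Rdiv_lt_0_compat; nra. }
assert (E : ln n - 2 * ln (n + 1) + ln (n + 2) = ln x).
{ unfold x; rewrite ln_div by nra; rewrite !ln_mult by lra; ring. }
rewrite E.
assert (H1 := ln_upper x Hx); assert (H2 := ln_lower x Hx).
assert (x <= 1).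
{ apply Rmult_le_reg_r with ((n + 1) * (n + 1)); [nra |].
  unfold x; replace (n * (n + 2) / ((n + 1) * (n + 1)) * ((n + 1) * (n + 1)))
    with (n * (n + 2)) by (field; lra); nra. }
assert (1 - / x = - / (n * (n + 2))) by (unfold x; field; nra).
assert (/ (n * (n + 2)) <= (/ n) ^ 2).
{ replace ((/ n) ^ 2) with (/ (n * n)) by (field; lra).
  apply Rinv_le_contravar; nra. }
apply Rabs_le; lra.
Qed.

Lemma log_asymp_differences (c : C) (L : nat -> C) : log_asymp c L ->
  exists P, 0 <= P /\ forall m,
    Cmod (L m - RtoC (2 * ln (INR (S m)))) <= P * / INR (S m) /\
    Cmod (L (S m) - L m) <= P * / INR (S m) /\
    Cmod (L m - 2 * L (S m) + L (S (S m))) <= P * (/ INR (S m)) ^ 2.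
Proof.
intros [K HK].
assert (HK0 : 0 <= K).
{ pose proof (HK 0%nat) as H; rewrite INR_1, Rinv_1 in H.
  pose proof (Cmod_ge_0 (L 0%nat - (RtoC (2 * ln 1) + c * RtoC 1))%C); lra. }
pose proof (Cmod_ge_0 c) as Hc.
exists (2 + 2 * Cmod c + 4 * K); split; [lra |].
intros m.
assert (Hn := INR_S_ge_1 m).
assert (H0 := HK m); assert (H1 := HK (S m)); assert (H2 := HK (S (S m))).
rewrite (S_INR (S (S m))) in H2; rewrite (S_INR (S m)) in H1, H2.
set (n := INR (S m)) in *.
set (e0 := (L m - _)%C) in H0; set (e1 := (L (S m) - _)%C) in H1;
  set (e2 := (L (S (S m)) - _)%C) in H2.
assert (Hr : 0 < / n <= 1).
{ split; [apply Rinv_0_lt_compat; lra |].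
  rewrite <- Rinv_1; apply Rinv_le_contravar; lra. }
assert (Hr1 : 0 < / (n + 1) <= / n).
{ split; [apply Rinv_0_lt_compat; lra | apply Rinv_le_contravar; lra]. }
assert (Hr2 : 0 < / (n + 1 + 1) <= / n).
{ split; [apply Rinv_0_lt_compat; lra | apply Rinv_le_contravar; lra]. }
set (r := / n) in *; set (r1 := / (n + 1)) in *; set (r2 := / (n + 1 + 1)) in *.
assert (K1 : K * r1 ^ 2 <= K * r ^ 2) by (apply Rmult_le_compat_l; nra).
assert (K2 : K * r2 ^ 2 <= K * r ^ 2) by (apply Rmult_le_compat_l; nra).
assert (Hrr : 0 <= r ^ 2 <= r) by nra.
assert (KR : 0 <= K * r ^ 2 <= K * r) by (split; [nra | apply Rmult_le_compat_l; lra]).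
assert (CR : 0 <= Cmod c * r ^ 2 <= Cmod c * r) by (split; [nra | apply Rmult_le_compat_l; lra]).
assert (CR1 : Cmod c * r <= Cmod c) by nra.
assert (KR1 : K * r <= K) by nra.
repeat split.
- replace (L m - RtoC (2 * ln n))%C with (c * RtoC r + e0)%C by (unfold e0; ring).
  apply Rle_trans with (1 := Cmod_triangle _ _).
  rewrite Cmod_mult, Cmod_R, Rabs_pos_eq by lra. lra.
- replace (L (S m) - L m)%C
    with (RtoC (2 * (ln (n + 1) - ln n)) + c * RtoC (r1 - r) + (e1 - e0))%C
    by (unfold e0, e1; rewrite !RtoC_mult, !RtoC_minus; ring).
  apply Rle_trans with (1 := Cmod_triangle _ _).
  assert (A := Cmod_triangle (RtoC (2 * (ln (n + 1) - ln n))) (c * RtoC (r1 - r))).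
  assert (B := Cmod_triangle_minus e1 e0).
  rewrite Cmod_mult, !Cmod_R, Rabs_mult, (Rabs_pos_eq 2) in A by lra.
  assert (D := ln_first_difference n Hn); fold r in D.
  assert (D2 : Cmod c * Rabs (r1 - r) <= Cmod c * r).
  { apply Rmult_le_compat_l; [exact Hc | apply Rabs_le; lra]. }
  lra.
- replace (L m - 2 * L (S m) + L (S (S m)))%C
    with (RtoC (2 * (ln n - 2 * ln (n + 1) + ln (n + 1 + 1))) + c * RtoC (r - 2 * r1 + r2)
      + (e0 - 2 * e1 + e2))%C
    by (unfold e0, e1, e2; rewrite !RtoC_mult, !RtoC_plus, !RtoC_minus, !RtoC_mult; ring).
  apply Rle_trans with (1 := Cmod_triangle _ _).
  assert (A := Cmod_triangle (RtoC (2 * (ln n - 2 * ln (n + 1) + ln (n + 1 + 1))))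
    (c * RtoC (r - 2 * r1 + r2))).
  assert (B := Cmod_triangle (e0 - 2 * e1) e2).
  assert (B' := Cmod_triangle_minus e0 (2 * e1)).
  rewrite (Cmod_mult 2 e1), Cmod_R, (Rabs_pos_eq 2) in B' by lra.
  rewrite Cmod_mult, !Cmod_R, Rabs_mult, (Rabs_pos_eq 2) in A by lra.
  assert (D := ln_second_difference n Hn); fold r in D.
  replace (n + 2) with (n + 1 + 1) in D by ring.
  assert (D2 : Cmod c * Rabs (r - 2 * r1 + r2) <= Cmod c * (2 * r ^ 2)).
  { apply Rmult_le_compat_l; [exact Hc |].
    replace (r - 2 * r1 + r2) with (2 * (r * (r1 * r2)))
      by (unfold r, r1, r2; field; lra).
    rewrite Rabs_pos_eq by (repeat apply Rmult_le_pos; lra).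
    assert (r * (r1 * r2) <= r * (r * 1)).
    { apply Rmult_le_compat_l; [lra |]; apply Rmult_le_compat; lra. }
    nra. }
  lra.
Qed.

Lemma quadratic_le_exp (x : R) : 0 <= x -> 1 + x + 4 * x ^ 2 <= 4113 * exp (/ 16 * x).
Proof.
intros Hx.
assert (H := exp_ineq1_le (x / 32)).
replace (/ 16 * x) with (x / 32 + x / 32) by field.
rewrite exp_plus; set (e := exp (x / 32)) in *.
assert (x <= 32 * e) by lra. assert (1 <= e) by lra.
nra.
Qed.

(** [|exp (- t w)|] is of order [n ^ (- 2 Re t) <= n ^ (1 / 4)], and the factor
    coming from a disc of radius [1 / 16], polynomial in [w] included, costs another
    [n ^ (1 / 4)]. *)
Lemma jet_Cexp_bound_le (t w : C) (n B : R) :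
  1 <= n -> - / 8 <= Re t -> Cmod (w - RtoC (2 * ln n)) <= B ->
  jet_Cexp_bound t (/ 16) w <= 4113 * exp (Cmod t * B + B / 8) * sqrt n.
Proof.
intros Hn Ht HB; unfold jet_Cexp_bound.
assert (Hl : 0 <= ln n) by (rewrite <- ln_1; apply ln_le; lra).
assert (Hw := Cmod_ge_0 w); assert (Htn := Cmod_ge_0 t).
set (v := (w - RtoC (2 * ln n))%C) in *.
assert (E1 : Cmod (Cexp (- t * w)) <= exp (/ 4 * ln n + Cmod t * B)).
{ rewrite Cmod_Cexp; apply exp_le.
  assert (Hv : Rabs (Re (t * v)) <= Cmod t * B).
  { apply Rle_trans with (1 := re_le_Cmod _); rewrite Cmod_mult.
    now apply Rmult_le_compat_l. }
  apply Rabs_le_between in Hv.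
  replace (Re (- t * w)) with (- (2 * ln n * Re t) - Re (t * v))
    by (unfold v; destruct t, w; simpl; ring).
  nra. }
assert (E2 : Cmod w <= 2 * ln n + B).
{ replace w with (RtoC (2 * ln n) + v)%C by (unfold v; ring).
  apply Rle_trans with (1 := Cmod_triangle _ _).
  rewrite Cmod_R, Rabs_pos_eq by lra; lra. }
assert (E3 : (1 + Cmod w + 4 * Cmod w ^ 2) * exp (/ 16 * Cmod w) <=
  4113 * exp (/ 4 * ln n + B / 8)).
{ apply Rle_trans with (4113 * exp (/ 16 * Cmod w) * exp (/ 16 * Cmod w)).
  - apply Rmult_le_compat_r; [left; apply exp_pos | now apply quadratic_le_exp].
  - rewrite Rmult_assoc, <- exp_plus; apply Rmult_le_compat_l; [lra | apply exp_le; lra]. }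
assert (Es : sqrt n = exp (/ 2 * ln n)).
{ rewrite <- Rpower_sqrt by lra; reflexivity. }
rewrite Es, !Rmult_assoc, <- exp_plus.
replace (Cmod t * B + B / 8 + / 2 * ln n)
  with ((/ 4 * ln n + Cmod t * B) + (/ 4 * ln n + B / 8)) by field.
rewrite exp_plus, (Rmult_comm 4113), Rmult_assoc, (Rmult_comm _ 4113).
apply Rmult_le_compat; auto using Cmod_ge_0.
apply Rmult_le_pos; [nra | left; apply exp_pos].
Qed.

(** * The accelerated alternating sum *)

Definition diff2 (u : nat -> C) (m : nat) : C := (u m - 2 * u (S m) + u (S (S m)))%C.

Definition alt (u : nat -> C) (m : nat) : C := (RtoC (-1) ^ m * u m)%C.

(** Euler's acceleration of the alternating sum of [u], applied twice.  It agrees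
    with the sum when the latter converges, and it exists as soon as the second
    differences of [u] are absolutely summable. *)
Definition altreg (u : nat -> C) : C :=
  (RtoC (3 / 4) * u 0%nat - RtoC (/ 4) * u 1%nat + RtoC (/ 4) * CSeries (alt (diff2 u)))%C.

Lemma Cmod_pow_m1 (m : nat) : Cmod (RtoC (-1) ^ m) = 1.
Proof.
rewrite Cmod_pow, Cmod_R, Rabs_left by lra.
replace (- -1) with 1 by ring; apply pow1.
Qed.

(** Two summations by parts.  The last term is the boundary term that separates the
    ordinary partial sums from the accelerated ones. *)
Lemma csum_alt (u : nat -> C) (n : nat) :
  csum (alt u) n =
  (RtoC (3 / 4) * u 0%nat - RtoC (/ 4) * u 1%nat + RtoC (/ 4) * csum (alt (diff2 u)) n
   + RtoC (-1) ^ n * (RtoC (3 / 4) * u (S n) - RtoC (/ 4) * u (S (S n))))%C.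
Proof.
assert (E : RtoC (3 / 4) = (3 * RtoC (/ 4))%C) by (rewrite <- RtoC_mult; f_equal; field).
assert (E4 : (4 * RtoC (/ 4))%C = 1%C) by (rewrite <- RtoC_mult; f_equal; field).
rewrite E; set (q := RtoC (/ 4)) in *.
(* [q] is opaque to [ring], so one term is multiplied by [4 * q = 1] by hand. *)
assert (U : forall z, z = (4 * q * z)%C) by (intros z; rewrite E4; ring).
induction n as [|n IH].
- rewrite !csum_O; unfold alt, diff2; change (RtoC (-1) ^ 0)%C with (RtoC 1).
  rewrite (U (1 * u 0%nat)%C); ring.
- rewrite !csum_S, IH; unfold alt, diff2; rewrite !Cpow_S.
  rewrite (U (-1 * (-1) ^ n * u (S n))%C); ring.
Qed.

Lemma ex_series_inv_sq : ex_series (fun m => (/ INR (S m)) ^ 2).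
Proof.
apply (ex_series_le (V := R_CompleteNormedModule)) with (2 := ex_series_sqrt_div_sq).
intros m; change (Rabs ((/ INR (S m)) ^ 2) <= (/ INR (S m)) ^ 2 * sqrt (INR (S m))).
assert (Hn := INR_S_ge_1 m).
rewrite Rabs_pos_eq by apply pow2_ge_0.
assert (1 <= sqrt (INR (S m))) by (rewrite <- sqrt_1; apply sqrt_le_1_alt, Hn).
pose proof (pow2_ge_0 (/ INR (S m))); nra.
Qed.

Lemma altreg_cv (c : C) (L : nat -> C) : log_asymp c L ->
  Ccv (csum (alt (diff2 L))) (CSeries (alt (diff2 L))).
Proof.
intros HL; destruct (log_asymp_differences c L HL) as [P [HP HD]].
apply (CSeries_bound _ (fun m => P * (/ INR (S m)) ^ 2)).
- intros m; unfold alt, diff2; rewrite Cmod_mult, Cmod_pow_m1, Rmult_1_l; apply HD.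
- exact (ex_series_scal_l P _ ex_series_inv_sq).
Qed.

(** The second differences of [exp (- s L)] are bounded by a constant times
    [n ^ (- 3 / 2)] for [Re s >= - 1 / 8], so that the accelerated sum is
    holomorphic across the line [Re s = 0]. *)
Lemma altreg_exp_jet (c : C) (L : nat -> C) (t : C) :
  log_asymp c L -> - / 8 <= Re t ->
  (exists K, jet t (/ 16) (fun s => altreg (fun k => Cexp (- s * L k)))
    (altreg (fun k => - L k * Cexp (- t * L k))%C) K) /\
  Ccv (csum (alt (diff2 (fun k => Cexp (- t * L k)))))
    (CSeries (alt (diff2 (fun k => Cexp (- t * L k))))).
Proof.
intros HL Ht.
destruct (log_asymp_differences c L HL) as [P [HP HD]].
destruct (jet_second_difference t (/ 16) P ltac:(lra) HP) as [M [HM HJ]].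
set (Q := M * (4113 * exp (Cmod t * P + P / 8))).
set (b := fun m => Q * ((/ INR (S m)) ^ 2 * sqrt (INR (S m)))).
assert (Hb : ex_series b) by exact (ex_series_scal_l Q _ ex_series_sqrt_div_sq).
assert (J : forall m, jet t (/ 16) (fun s => alt (diff2 (fun k => Cexp (- s * L k))) m)
  (alt (diff2 (fun k => - L k * Cexp (- t * L k))%C) m) (b m)).
{ intros m; unfold alt, diff2.
  assert (Hn := INR_S_ge_1 m).
  destruct (HD m) as [D0 [D1 D2]].
  assert (Hr := inv_INR_S_bounds m).
  assert (D0' : Cmod (L m - RtoC (2 * ln (INR (S m)))) <= P) by nra.
  assert (J := HJ (L m) (L (S m)) (L (S (S m))) (/ INR (S m)) ltac:(lra) D1 D2).
  assert (J' := jet_scal _ _ (RtoC (-1) ^ m)%C _ _ _ J).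
  rewrite Cmod_pow_m1, Rmult_1_l in J'.
  eapply jet_weaken; [| exact J'].
  assert (HB := jet_Cexp_bound_le t (L m) (INR (S m)) P Hn Ht D0').
  unfold b, Q.
  replace (M * (4113 * exp (Cmod t * P + P / 8)) * ((/ INR (S m)) ^ 2 * sqrt (INR (S m))))
    with (M * (/ INR (S m)) ^ 2 * (4113 * exp (Cmod t * P + P / 8) * sqrt (INR (S m)))) by ring.
  apply Rmult_le_compat_l; [| exact HB].
  apply Rmult_le_pos; [exact HM | apply pow2_ge_0]. }
split.
- assert (JS := jet_series t (/ 16) _ _ _ ltac:(lra) J Hb).
  assert (J0 := jet_scal _ _ (RtoC (3 / 4)) _ _ _ (jet_Cexp t (/ 16) (L 0%nat) ltac:(lra))).
  assert (J1 := jet_scal _ _ (- RtoC (/ 4))%C _ _ _ (jet_Cexp t (/ 16) (L 1%nat) ltac:(lra))).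
  assert (J2 := jet_scal _ _ (RtoC (/ 4)) _ _ _ JS).
  assert (Eo : forall z w : C, (- z * w = - (z * w))%C) by (intros; ring).
  eexists.
  apply jet_ext with (3 := jet_plus _ _ _ _ _ _ _ _ (jet_plus _ _ _ _ _ _ _ _ J0 J1) J2).
  + intros s; cbv beta; rewrite (Eo (RtoC (/ 4))); reflexivity.
  + rewrite (Eo (RtoC (/ 4))); reflexivity.
- exact (proj1 (CSeries_bound _ b (fun m => proj1 (J m)) Hb)).
Qed.

Lemma Cexp_log_asymp_vanishes (c : C) (L : nat -> C) (s : C) :
  log_asymp c L -> 0 < Re s -> Ccv (fun m => Cexp (- s * L m)) 0%C.
Proof.
intros HL Hs.
destruct (log_asymp_differences c L HL) as [P [HP HD]].
apply Ccv_0 with (fun m => exp (Cmod s * P) * exp (- (2 * Re s) * ln (INR (S m)))).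
- intros m; destruct (HD m) as [D0 _].
  assert (Hr := inv_INR_S_bounds m).
  set (l := ln (INR (S m))) in *.
  set (v := (L m - RtoC (2 * l))%C) in *.
  rewrite <- exp_plus, Cmod_Cexp; apply exp_le.
  assert (Hv : Rabs (Re (s * v)) <= Cmod s * P).
  { apply Rle_trans with (1 := re_le_Cmod _); rewrite Cmod_mult.
    apply Rmult_le_compat_l; [apply Cmod_ge_0 | nra]. }
  apply Rabs_le_between in Hv.
  replace (Re (- s * L m)) with (- (2 * l * Re s) - Re (s * v))
    by (unfold v; destruct s, (L m); simpl; ring).
  lra.
- replace (Finite 0) with (Finite (exp (Cmod s * P) * 0)) by (f_equal; ring).
  apply is_lim_seq_mult'; [apply is_lim_seq_const |].
  apply (is_lim_comp_seq exp _ m_infty 0 is_lim_exp_m).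
  + exists 0%nat; intros n _; discriminate.
  + apply (is_lim_seq_incr_1 (fun n => - (2 * Re s) * ln (INR n))).
    replace m_infty with (Rbar_mult (Finite (- (2 * Re s))) p_infty).
    2: { simpl; destruct (Rle_dec 0 (- (2 * Re s))) as [H | H]; [exfalso; lra | reflexivity]. }
    apply is_lim_seq_scal_l.
    apply (is_lim_comp_seq ln INR p_infty p_infty is_lim_ln_p).
    * exists 0%nat; intros n _; discriminate.
    * apply is_lim_seq_INR.
Qed.

(** For [Re s > 0] the boundary term of [csum_alt] vanishes in the limit, so the
    accelerated sum is the sum of the series; its derivative at [0] is minus the
    accelerated sum of the logarithms themselves. *)
Theorem is_zeta_prod_of_logs (b : nat -> list C) (c : C) (L : nat -> C) :
  (forall m z, In z (b m) -> z <> 0%C) ->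
  (forall m s, zeta_term (b m) s = Cexp (- s * L m)) ->
  log_asymp c L ->
  is_zeta_prod b (Cexp (altreg L)).
Proof.
intros Hnz Hz HL; split; [exact Hnz |].
set (F := fun s : C => altreg (fun k => Cexp (- s * L k))).
assert (HF : forall s, - / 8 <= Re s ->
  is_derive (K := C_AbsRing) (V := C_NormedModule) F s
    (altreg (fun k => - L k * Cexp (- s * L k))%C)).
{ intros s Hs; destruct (altreg_exp_jet c L s HL Hs) as [[K J] _].
  apply jet_is_derive with (2 := J); lra. }
exists F, (altreg (fun k => - L k * Cexp (- RtoC 0 * L k))%C).
split; [| split; [| split]].
- intros s Hs; split; [eexists; apply HF; lra |].
  apply is_series_of_Ccv.
  destruct (altreg_exp_jet c L s HL ltac:(lra)) as [_ Cs].
  assert (C0 := Cexp_log_asymp_vanishes c L s HL Hs).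
  set (u := fun k => Cexp (- s * L k)) in *.
  apply Ccv_ext with (csum (alt u)).
  { intros n; apply csum_ext; intros m; unfold alt, u; now rewrite Hz. }
  apply Ccv_ext with (1 := fun n => eq_sym (csum_alt u n)).
  replace (F s) with (F s + 0)%C by ring; unfold F, altreg; fold u.
  apply Ccv_plus; [apply Ccv_plus; [apply Ccv_const |] |].
  { apply Ccv_mult; [apply Ccv_const | exact Cs]. }
  assert (C1 : Ccv (fun n => u (S n)) 0%C).
  { apply (Ccv_subseq u 0%C S); [| exact C0].
    apply eventually_subseq; intros n; lia. }
  assert (C2 : Ccv (fun n => u (S (S n))) 0%C).
  { apply (Ccv_subseq u 0%C (fun n => S (S n))); [| exact C0].
    apply eventually_subseq; intros n; lia. }
  assert (C3 : Ccv (fun n => RtoC (3 / 4) * u (S n) - RtoC (/ 4) * u (S (S n)))%C 0%C).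
  { replace (RtoC 0) with (RtoC (3 / 4) * 0 - RtoC (/ 4) * 0)%C by ring.
    apply Ccv_minus; apply Ccv_mult; auto using Ccv_const. }
  set (w := fun n => (RtoC (3 / 4) * u (S n) - RtoC (/ 4) * u (S (S n)))%C) in *.
  change (Ccv (fun n => RtoC (-1) ^ n * w n)%C 0%C).
  apply Ccv_0 with (fun n => Cmod (w n)).
  + intros n; rewrite Cmod_mult, Cmod_pow_m1; lra.
  + now apply Ccv_Cmod_0.
- (* Balls of [C] are squares, so membership bounds [Re s] directly. *)
  exists (mkposreal (/ 8) ltac:(lra)); intros s [H1 _].
  eexists; apply HF.
  change (Rabs (Re s - 0) < / 8) in H1; apply Rabs_lt_between in H1; lra.
- apply HF; simpl; lra.
- f_equal.
  assert (E : forall k, (- L k * Cexp (- RtoC 0 * L k))%C = (RtoC (-1) * L k)%C).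
  { intros k; replace (- RtoC 0 * L k)%C with (RtoC 0) by ring; rewrite Cexp_0; ring. }
  set (v := fun k => (- L k * Cexp (- RtoC 0 * L k))%C) in *.
  assert (Es : CSeries (alt (diff2 v)) = (- CSeries (alt (diff2 L)))%C).
  { apply CSeries_unique.
    apply Ccv_ext with (fun n => - csum (alt (diff2 L)) n)%C;
      [| now apply Ccv_opp, (altreg_cv c)].
    intros n; replace (- csum (alt (diff2 L)) n)%C
      with (RtoC (-1) * csum (alt (diff2 L)) n)%C by ring.
    rewrite <- csum_scal; apply csum_ext; intros m.
    unfold alt, diff2, v; rewrite !E; ring. }
  unfold altreg; rewrite Es; unfold v; rewrite !E; ring.
Qed.

(** * Wallis product and alternating harmonic series *)

Definition sin_int (n : nat) : R := RInt (fun x => sin x ^ n) 0 (PI / 2).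

Lemma ex_RInt_sin_pow (n : nat) : ex_RInt (fun x => sin x ^ n) 0 (PI / 2).
Proof.
apply (ex_RInt_continuous (V := R_CompleteNormedModule)); intros x _.
apply (ex_derive_continuous (K := R_AbsRing) (V := R_NormedModule)); auto_derive; easy.
Qed.

(** [- cos x * sin x ^ (n + 1)] vanishes at both ends of [[0, PI / 2]], and the
    integral of its derivative is the difference of the two sides. *)
Lemma sin_int_recurrence (n : nat) :
  INR (S (S n)) * sin_int (S (S n)) = INR (S n) * sin_int n.
Proof.
assert (H : is_RInt (fun x => INR (S (S n)) * sin x ^ (S (S n)) - INR (S n) * sin x ^ n)
  0 (PI / 2) 0).
{ replace 0 with (minus (- cos (PI / 2) * sin (PI / 2) ^ (S n)) (- cos 0 * sin 0 ^ (S n))) at 2.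
  2: { rewrite cos_PI2, sin_0; unfold minus, plus, opp; simpl; ring. }
  apply (is_RInt_derive (V := R_CompleteNormedModule) (fun x => - cos x * sin x ^ (S n))).
  - intros x _; auto_derive; [easy |].
    change (Init.Nat.pred (S n)) with n; rewrite (S_INR (S n)).
    change (sin x ^ S (S n)) with (sin x * (sin x * sin x ^ n)).
    change (sin x ^ S n) with (sin x * sin x ^ n).
    assert (E := sin2_cos2 x); unfold Rsqr in E.
    replace (INR (S n) * sin x ^ n)
      with (INR (S n) * sin x ^ n * (sin x * sin x + cos x * cos x)) by (rewrite E; ring).
    change (match n with 0%nat => 1 | S _ => INR n + 1 end) with (INR (S n)).
    ring.
  - intros x _.
    apply (ex_derive_continuous (K := R_AbsRing) (V := R_NormedModule)); auto_derive; easy. }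
apply (is_RInt_unique (V := R_CompleteNormedModule)) in H.
assert (E : RInt (fun x => INR (S (S n)) * sin x ^ (S (S n)) - INR (S n) * sin x ^ n) 0 (PI / 2)
  = INR (S (S n)) * sin_int (S (S n)) - INR (S n) * sin_int n).
{ apply is_RInt_unique, (is_RInt_minus (V := R_NormedModule));
  apply (is_RInt_scal (V := R_NormedModule));
  apply (RInt_correct (V := R_CompleteNormedModule)), ex_RInt_sin_pow. }
lra.
Qed.

Lemma sin_int_decreasing (n : nat) : sin_int (S n) <= sin_int n.
Proof.
apply RInt_le; auto using ex_RInt_sin_pow.
- pose proof PI_RGT_0; lra.
- intros x Hx; simpl.
  assert (0 <= sin x) by (apply sin_ge_0; lra).
  assert (0 <= sin x ^ n) by now apply pow_le.
  pose proof (SIN_bound x); nra.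
Qed.

(** The product of the [m ^ ((-1) ^ m)] for [1 <= m <= 2 * N]. *)
Fixpoint wallis (N : nat) : R :=
  match N with
  | O => 1
  | S k => wallis k * (INR (2 * k + 2) / INR (2 * k + 1))
  end.

Lemma wallis_pos (N : nat) : 0 < wallis N.
Proof.
induction N as [|k IH]; [simpl; lra | cbn [wallis]].
apply Rmult_lt_0_compat; [exact IH |].
apply Rdiv_lt_0_compat; apply lt_0_INR; lia.
Qed.

Lemma sin_int_wallis (N : nat) :
  sin_int (2 * N) = PI / 2 / wallis N /\
  sin_int (2 * N + 1) = wallis N / INR (2 * N + 1).
Proof.
induction N as [|k [IH1 IH2]].
- split; unfold sin_int; cbn [wallis Nat.mul Nat.add].
  + apply is_RInt_unique.
    replace (PI / 2 / 1) with (scal (PI / 2 - 0) 1)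
      by (unfold scal; simpl; unfold mult; simpl; field).
    apply (is_RInt_ext (V := R_NormedModule) (fun _ => 1)); [reflexivity |].
    apply (is_RInt_const (V := R_NormedModule)).
  + apply is_RInt_unique.
    replace (1 / INR 1) with (minus (- cos (PI / 2)) (- cos 0))
      by (rewrite cos_PI2, cos_0; unfold minus, plus, opp; simpl; field).
    apply (is_RInt_derive (V := R_CompleteNormedModule) (fun x => - cos x)).
    * intros x _; auto_derive; [easy | simpl; ring].
    * intros x _.
      apply (ex_derive_continuous (K := R_AbsRing) (V := R_NormedModule)); auto_derive; easy.
- assert (Hw := wallis_pos k).
  assert (A := sin_int_recurrence (2 * k)); assert (B := sin_int_recurrence (2 * k + 1)).
  rewrite IH1 in A; rewrite IH2 in B; cbn [wallis].
  replace (2 * S k)%nat with (S (S (2 * k))) by lia.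
  replace (S (S (2 * k)) + 1)%nat with (S (S (2 * k + 1))) by lia.
  replace (2 * k + 2)%nat with (S (S (2 * k))) by lia.
  replace (2 * k + 1)%nat with (S (2 * k)) in * by lia.
  assert (0 < INR (S (2 * k))) by (apply lt_0_INR; lia).
  assert (0 < INR (S (S (2 * k)))) by (apply lt_0_INR; lia).
  assert (0 < INR (S (S (S (2 * k))))) by (apply lt_0_INR; lia).
  split.
  + apply Rmult_eq_reg_l with (INR (S (S (2 * k)))); [rewrite A; field | ]; repeat split; lra.
  + apply Rmult_eq_reg_l with (INR (S (S (S (2 * k))))); [rewrite B; field | ]; repeat split; lra.
Qed.

Lemma wallis_limit : is_lim_seq (fun N => wallis N ^ 2 / INR (2 * N + 1)) (PI / 2).
Proof.
assert (Hpi := PI_RGT_0).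
apply is_lim_seq_le_le with (fun N => PI / 2 * (1 - / INR (S N))) (fun _ => PI / 2).
- intros N; assert (Hw := wallis_pos N).
  destruct (sin_int_wallis N) as [E1 E2]; destruct (sin_int_wallis (S N)) as [E3 _].
  assert (D1 := sin_int_decreasing (2 * N)); assert (D2 := sin_int_decreasing (2 * N + 1)).
  replace (S (2 * N)) with (2 * N + 1)%nat in D1 by lia.
  replace (S (2 * N + 1)) with (2 * S N)%nat in D2 by lia.
  rewrite E1, E2 in D1; rewrite E2, E3 in D2; cbn [wallis] in D2.
  assert (H1 : INR (2 * N + 1) = 2 * INR N + 1) by (rewrite plus_INR, mult_INR; simpl; ring).
  assert (H2 : INR (2 * N + 2) = 2 * INR N + 2) by (rewrite plus_INR, mult_INR; simpl; ring).
  rewrite S_INR; rewrite H1, H2 in *.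
  assert (Hn := pos_INR N); set (n := INR N) in *; set (w := wallis N) in *.
  split.
  + apply Rle_trans with (PI / 2 / (w * ((2 * n + 2) / (2 * n + 1))) * w).
    * replace (PI / 2 / (w * ((2 * n + 2) / (2 * n + 1))) * w)
        with (PI / 2 * ((2 * n + 1) / (2 * n + 2))) by (field; lra).
      apply Rmult_le_compat_l; [lra |].
      replace (1 - / (n + 1)) with (2 * n / (2 * n + 2)) by (field; lra).
      apply Rmult_le_compat_r; [left; apply Rinv_0_lt_compat; lra | lra].
    * replace (w ^ 2 / (2 * n + 1)) with (w / (2 * n + 1) * w) by (field; lra).
      apply Rmult_le_compat_r; lra.
  + replace (w ^ 2 / (2 * n + 1)) with (w / (2 * n + 1) * w) by (field; lra).
    replace (PI / 2) with (PI / 2 / w * w) at 1 by (field; lra).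
    apply Rmult_le_compat_r; lra.
- replace (Finite (PI / 2)) with (Finite (PI / 2 * (1 - 0))) by (f_equal; ring).
  apply is_lim_seq_mult'; [apply is_lim_seq_const |].
  apply is_lim_seq_minus'; [apply is_lim_seq_const | apply is_lim_seq_inv_INR_S].
- apply is_lim_seq_const.
Qed.

Fixpoint harmonic (N : nat) : R :=
  match N with O => 0 | S k => harmonic k + / INR (S k) end.

Fixpoint alt_harmonic (N : nat) : R :=
  match N with O => 0 | S k => alt_harmonic k + (-1) ^ k * / INR (S k) end.

Lemma alt_harmonic_even (N : nat) :
  alt_harmonic (2 * N) = harmonic (2 * N) - harmonic N.
Proof.
induction N as [|k IH]; [simpl; ring |].
replace (2 * S k)%nat with (S (S (2 * k))) by lia.
cbn [alt_harmonic harmonic]; rewrite IH.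
replace ((-1) ^ S (2 * k)) with (-1) by (symmetry; apply pow_1_odd).
rewrite pow_1_even.
replace (INR (S (S (2 * k)))) with (2 * INR (S k)) by (rewrite !S_INR, mult_INR; simpl; ring).
assert (0 < INR (S k)) by (apply lt_0_INR; lia).
assert (0 < INR (S (2 * k))) by (apply lt_0_INR; lia).
field; lra.
Qed.

(** Euler's constant: only the existence of the limit matters, since it cancels
    in [harmonic (2 * N) - harmonic N]. *)
Lemma harmonic_minus_ln_cv :
  exists g : R, is_lim_seq (fun N => harmonic (S N) - ln (INR (S N))) g.
Proof.
destruct (ex_finite_lim_seq_decr (fun N => harmonic (S N) - ln (INR (S N))) 0) as [g Hg].
- intros N; cbn [harmonic]; rewrite (S_INR (S N)).
  assert (Hn := INR_S_ge_1 N); set (n := INR (S N)) in *.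
  assert (H := ln_lower ((n + 1) / n) ltac:(apply Rdiv_lt_0_compat; lra)).
  rewrite ln_div in H by lra.
  replace (1 - / ((n + 1) / n)) with (/ (n + 1)) in H by (field; lra).
  lra.
- intros N.
  assert (H : ln (INR (S N) + 1) <= harmonic (S N)).
  { induction N as [|k IH].
    - simpl; assert (H := ln_upper (1 + 1) ltac:(lra)); lra.
    - cbn [harmonic] in *; rewrite (S_INR (S k)).
      assert (Hn := INR_S_ge_1 k); set (n := INR (S k)) in *.
      assert (H := ln_upper ((n + 1 + 1) / (n + 1)) ltac:(apply Rdiv_lt_0_compat; lra)).
      rewrite ln_div in H by lra.
      replace ((n + 1 + 1) / (n + 1) - 1) with (/ (n + 1)) in H by (field; lra).
      lra. }
  assert (Hn := INR_S_ge_1 N).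
  assert (ln (INR (S N)) <= ln (INR (S N) + 1)) by (apply ln_le; lra).
  lra.
- now exists g.
Qed.

Lemma alt_harmonic_even_limit : is_lim_seq (fun N => alt_harmonic (2 * N)) (ln 2).
Proof.
destruct harmonic_minus_ln_cv as [g Hg].
apply is_lim_seq_incr_1.
set (c := fun N => harmonic (S N) - ln (INR (S N))) in *.
apply is_lim_seq_ext with (fun N => (c (2 * N + 1)%nat - c N) + ln 2).
- intros N; rewrite alt_harmonic_even; unfold c.
  replace (S (2 * N + 1)) with (2 * S N)%nat by lia.
  rewrite mult_INR, ln_mult; [change (INR 2) with 2; ring | simpl; lra | apply lt_0_INR; lia].
- replace (Finite (ln 2)) with (Finite ((g - g) + ln 2)) by (f_equal; ring).
  apply is_lim_seq_plus'; [| apply is_lim_seq_const].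
  apply is_lim_seq_minus'; [| exact Hg].
  apply (is_lim_seq_subseq c g (fun N => (2 * N + 1)%nat)); [| exact Hg].
  apply eventually_subseq; intros n; lia.
Qed.

(** * Alternating products *)

(** The partial products of [mod_gamma]: the exponent of [z m] is
    [(-1) ^ (m + 1)], the inverse of the one in the zeta-regularized product. *)
Definition altprod (z : nat -> C) (N : nat) : C :=
  Cprod (map (fun m => Calt_pow (z m) (S m)) (seq 1 N)).

Lemma Cprod_app (l k : list C) : Cprod (l ++ k) = (Cprod l * Cprod k)%C.
Proof.
unfold Cprod; induction l as [|z l IH]; simpl; [ring | rewrite IH; ring].
Qed.

Lemma altprod_S (z : nat -> C) (N : nat) :
  altprod z (S N) = (altprod z N * Calt_pow (z (S N)) N)%C.
Proof.
unfold altprod; rewrite seq_S, map_app, Cprod_app; f_equal.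
change (Calt_pow (z (S N)) N * 1 = Calt_pow (z (S N)) N)%C; ring.
Qed.

Lemma Calt_pow_mult (z w : C) (n : nat) : z <> 0%C -> w <> 0%C ->
  Calt_pow (z * w) n = (Calt_pow z n * Calt_pow w n)%C.
Proof.
intros Hz Hw; unfold Calt_pow; destruct (Nat.even n); [easy |].
field; auto.
Qed.

Lemma altprod_mult (z w : nat -> C) (N : nat) :
  (forall m, z (S m) <> 0%C) -> (forall m, w (S m) <> 0%C) ->
  altprod (fun m => z m * w m)%C N = (altprod z N * altprod w N)%C.
Proof.
intros Hz Hw; induction N as [|N IH]; [unfold altprod; simpl; ring |].
rewrite !altprod_S, IH, Calt_pow_mult by auto; ring.
Qed.

Lemma altprod_ext (z w : nat -> C) (N : nat) :
  (forall m, z (S m) = w (S m)) -> altprod z N = altprod w N.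
Proof.
intros H; induction N as [|N IH]; [reflexivity |].
now rewrite !altprod_S, IH, H.
Qed.

Lemma pow_m1_cases (n : nat) :
  (Nat.even n = true /\ (RtoC (-1) ^ n)%C = 1%C) \/
  (Nat.even n = false /\ (RtoC (-1) ^ n)%C = (- (1))%C).
Proof.
induction n as [|n [[H1 H2] | [H1 H2]]].
- left; split; reflexivity.
- right; rewrite Nat.even_succ, <- Nat.negb_even, H1, Cpow_S, H2; split; [reflexivity | ring].
- left; rewrite Nat.even_succ, <- Nat.negb_even, H1, Cpow_S, H2; split; [reflexivity | ring].
Qed.

Lemma Calt_pow_Cexp (l : C) (n : nat) :
  Calt_pow (Cexp l) n = Cexp (RtoC (-1) ^ n * l).
Proof.
unfold Calt_pow; destruct (pow_m1_cases n) as [[-> ->] | [-> ->]].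
- f_equal; ring.
- rewrite <- Cexp_opp; f_equal; ring.
Qed.

Lemma altprod_Cexp (l : nat -> C) (N : nat) :
  altprod (fun m => Cexp (l m)) (S N) = Cexp (csum (alt (fun m => l (S m))) N).
Proof.
induction N as [|N IH].
- rewrite altprod_S, csum_O, Calt_pow_Cexp.
  change (1 * Cexp (alt (fun m => l (S m)) 0) = Cexp (alt (fun m => l (S m)) 0))%C; ring.
- rewrite altprod_S, IH, csum_S, Cexp_plus, Calt_pow_Cexp; reflexivity.
Qed.

Lemma Cexp_csum_alt (A L : nat -> C) (N : nat) :
  (forall m, Cexp (L m) = A m) -> (forall m, A m <> 0%C) ->
  Cexp (csum (alt L) N) = (A 0%nat / altprod A N)%C /\ altprod A N <> 0%C.
Proof.
intros HL HA; induction N as [|N [IH1 IH2]].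
- rewrite csum_O; unfold alt, altprod; simpl.
  rewrite <- HL; replace (1 * L 0%nat)%C with (L 0%nat) by ring.
  split; [field |]; apply C1_nz.
- rewrite csum_S, Cexp_plus, IH1, altprod_S; unfold alt.
  rewrite <- Calt_pow_Cexp, HL; unfold Calt_pow.
  rewrite Nat.even_succ, <- Nat.negb_even.
  assert (Hi : (/ A (S N))%C <> 0%C).
  { rewrite <- HL, <- Cexp_opp; apply Cexp_neq_0. }
  destruct (Nat.even N); simpl negb; cbv iota;
    (split; [field; auto | now apply Cmult_neq_0]).
Qed.

Lemma RtoC_INR_S_neq_0 (m : nat) : RtoC (INR (S m)) <> 0%C.
Proof. intros H; apply (not_0_INR (S m)); [lia | now injection H]. Qed.

Lemma altprod_INR_even (N : nat) :
  altprod (fun m => RtoC (INR m)) (2 * N) = (/ RtoC (wallis N))%C.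
Proof.
induction N as [|k IH].
- unfold altprod; simpl; field; apply C1_nz.
- replace (2 * S k)%nat with (S (S (2 * k))) by lia.
  rewrite !altprod_S, IH; cbn [wallis]; unfold Calt_pow.
  rewrite Nat.even_succ, <- Nat.negb_even.
  replace (Nat.even (2 * k)) with true by (symmetry; apply Nat.even_spec; now exists k).
  simpl negb; cbv iota.
  replace (2 * k + 2)%nat with (S (S (2 * k))) by lia.
  replace (2 * k + 1)%nat with (S (2 * k)) by lia.
  assert (Hw := wallis_pos k).
  rewrite RtoC_mult, RtoC_div by (apply not_0_INR; lia).
  field; repeat split; try apply RtoC_INR_S_neq_0.
  intros H; injection H; lra.
Qed.

Lemma altprod_Cexp_div (a : C) (N : nat) :
  altprod (fun m => Cexp (- (a / RtoC (INR m)))) N = Cexp (- (a * RtoC (alt_harmonic N))).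
Proof.
induction N as [|N IH].
- unfold altprod; simpl.
  replace (- (a * 0))%C with (RtoC 0) by ring; now rewrite Cexp_0.
- rewrite altprod_S, IH, Calt_pow_Cexp, <- Cexp_plus; f_equal.
  cbn [alt_harmonic].
  rewrite RtoC_plus, RtoC_mult, RtoC_inv, RtoC_pow by (apply not_0_INR; lia).
  field; apply RtoC_INR_S_neq_0.
Qed.

Lemma finite_prefix_bound (u : nat -> R) (N : nat) :
  exists B, 0 <= B /\ forall m, (m < N)%nat -> u m <= B.
Proof.
induction N as [|N [B [HB H]]].
- exists 0; split; [lra | lia].
- exists (B + Rabs (u N)); pose proof (Rabs_pos (u N)); split; [lra |].
  intros m Hm; destruct (Nat.eq_dec m N) as [-> | Hne].
  + pose proof (Rle_abs (u N)); lra.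
  + specialize (H m ltac:(lia)); lra.
Qed.

(** [(m + 1) ^ 2 * u m] is bounded on any finite range of indices, so an eventual
    bound becomes a uniform one at the price of a larger constant. *)
Lemma inv_sq_bound_of_eventually (u : nat -> R) (K : R) (N : nat) :
  (forall m, (N <= m)%nat -> u m <= K * (/ INR (S m)) ^ 2) ->
  exists K', forall m, u m <= K' * (/ INR (S m)) ^ 2.
Proof.
intros H.
destruct (finite_prefix_bound (fun m => u m * INR (S m) ^ 2) N) as [B [HB HN]].
exists (Rmax K B); intros m.
assert (Hn := INR_S_ge_1 m); set (n := INR (S m)) in *.
assert (Hi : 0 <= (/ n) ^ 2) by apply pow2_ge_0.
destruct (le_lt_dec N m) as [Hm | Hm].
- apply Rle_trans with (1 := H m Hm), Rmult_le_compat_r; [exact Hi | apply Rmax_l].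
- apply Rle_trans with (B * (/ n) ^ 2).
  + specialize (HN m Hm); fold n in HN; cbv beta in HN.
    replace (u m) with (u m * n ^ 2 * (/ n) ^ 2) by (unfold n; field; fold n; lra).
    now apply Rmult_le_compat_r.
  + apply Rmult_le_compat_r; [exact Hi | apply Rmax_r].
Qed.

Lemma eventually_INR_ge (x : R) : exists N, forall m, (N <= m)%nat -> x <= INR (S m).
Proof.
destruct (INR_unbounded x) as [N HN].
exists N; intros m Hm; apply Rle_trans with (INR N); [lra | apply le_INR; lia].
Qed.

Lemma Clog_1_plus_div (a : C) :
  exists N, forall m, (N <= m)%nat ->
  Cmod (Clog (1 + a * RtoC (/ INR (S m))) - a * RtoC (/ INR (S m))) <=
  576 * Cmod a ^ 2 * (/ INR (S m)) ^ 2.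
Proof.
destruct (eventually_INR_ge (2 * Cmod a)) as [N HN].
exists N; intros m Hm; specialize (HN m Hm).
assert (Hn := INR_S_ge_1 m); set (n := INR (S m)) in *.
assert (Hi : 0 < / n) by (apply Rinv_0_lt_compat; lra).
assert (E : Cmod (a * RtoC (/ n)) = Cmod a * / n).
{ rewrite Cmod_mult, Cmod_R, Rabs_pos_eq by lra; reflexivity. }
apply Rle_trans with (576 * Cmod (a * RtoC (/ n)) ^ 2).
- apply Clog_1_plus_taylor; rewrite E.
  apply Rmult_le_reg_r with n; [lra |].
  rewrite Rmult_assoc, Rinv_l by lra; lra.
- rewrite E; right; ring.
Qed.

Lemma one_plus_div_neq_0 (a : C) (m : nat) :
  (forall n : nat, a <> (- RtoC (INR n))%C) -> (1 + a / RtoC (INR (S m)))%C <> 0%C.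
Proof.
intros Ha H; apply (Ha (S m)).
assert (Hm := RtoC_INR_S_neq_0 m).
transitivity ((1 + a / RtoC (INR (S m))) * RtoC (INR (S m)) - RtoC (INR (S m)))%C.
- field; exact Hm.
- rewrite H; ring.
Qed.

(** The factor of index [m] has logarithm [O(1 / m ^ 2)], so the product is the
    exponential of an absolutely convergent series; in particular its limit is not
    zero. *)
Lemma mod_gamma_factor_limit (a : C) : (forall n : nat, a <> (- RtoC (INR n))%C) ->
  exists Q : C, Q <> 0%C /\
    Ccv (altprod (fun m => Cexp (- (a / RtoC (INR m))) * (1 + a / RtoC (INR m)))%C) Q /\
    mod_gamma a = (/ a * Cexp (a * RtoC (ln 2)) * Q)%C.
Proof.
intros Ha.
set (l := fun m => (Clog (1 + a / RtoC (INR m)) - a / RtoC (INR m))%C).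
assert (Hl : exists K, forall m, Cmod (l (S m)) <= K * (/ INR (S m)) ^ 2).
{ destruct (Clog_1_plus_div a) as [N HN].
  apply (inv_sq_bound_of_eventually (fun m => Cmod (l (S m))) (576 * Cmod a ^ 2) N).
  intros m Hm; unfold l, Cdiv; rewrite <- RtoC_inv by (apply not_0_INR; lia).
  now apply HN. }
destruct Hl as [K HK].
destruct (CSeries_bound (alt (fun m => l (S m))) (fun m => K * (/ INR (S m)) ^ 2)) as [Cs _].
{ intros m; unfold alt; rewrite Cmod_mult, Cmod_pow_m1, Rmult_1_l; apply HK. }
{ exact (ex_series_scal_l K _ ex_series_inv_sq). }
set (z := fun m => (Cexp (- (a / RtoC (INR m))) * (1 + a / RtoC (INR m)))%C).
assert (Cz : Ccv (altprod z) (Cexp (CSeries (alt (fun m => l (S m)))))).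
{ destruct (Ccv_Cexp _ _ Cs) as [H1 H2].
  assert (E : forall n, Cexp (csum (alt (fun m => l (S m))) n) = altprod z (S n)).
  { intros n; rewrite <- altprod_Cexp; apply altprod_ext; intros m; unfold z, l.
    unfold Cminus; rewrite Cexp_plus, Cexp_Clog by now apply one_plus_div_neq_0.
    ring. }
  split; apply is_lim_seq_incr_1;
    [apply is_lim_seq_ext with (2 := H1) | apply is_lim_seq_ext with (2 := H2)];
    intros n; now rewrite E. }
exists (Cexp (CSeries (alt (fun m => l (S m))))).
split; [apply Cexp_neq_0 | split; [exact Cz |]].
rewrite <- (Ccv_Clim_seq _ _ Cz); reflexivity.
Qed.

(** Scaling by a positive number does not change the argument, so this instance of
    additivity of the logarithm holds without any multiple of [2 * PI * i]. *)
Lemma Clog_pos_scal (r : R) (z : C) : 0 < r -> z <> 0%C ->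
  Clog (RtoC r * z) = (RtoC (ln r) + Clog z)%C.
Proof.
intros Hr Hz.
assert (Hm : 0 < Cmod z) by now apply Cmod_gt_0.
assert (E : Cmod (RtoC r * z) = r * Cmod z).
{ rewrite Cmod_mult, Cmod_R, Rabs_pos_eq by lra; reflexivity. }
assert (ERe : Re (RtoC r * z) = r * Re z) by (destruct z; simpl; ring).
assert (EIm : Im (RtoC r * z) = r * Im z) by (destruct z; simpl; ring).
unfold Clog; rewrite E, ln_mult by lra.
unfold Cplus, RtoC at 3; cbn [fst snd]; f_equal.
rewrite Rplus_0_l; unfold Carg; rewrite E, ERe, EIm.
replace (r * Re z / (r * Cmod z)) with (Re z / Cmod z) by (field; lra).
destruct (Rle_dec 0 (r * Im z)), (Rle_dec 0 (Im z)); try reflexivity; exfalso; nra.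
Qed.

(** * Value of the regularized product *)

(** The boundary term of [csum_alt] for the logarithms themselves does not tend to
    zero: it behaves like [ln n], half of the leading term [2 * ln n]. *)
Lemma altreg_boundary (c : C) (L : nat -> C) : log_asymp c L ->
  Ccv (fun n => RtoC (3 / 4) * L (S n) - RtoC (/ 4) * L (S (S n)) - RtoC (ln (INR (S n))))%C 0%C.
Proof.
intros HL; destruct (log_asymp_differences c L HL) as [P [HP HD]].
apply Ccv_0 with (fun n => (5 / 2 + P) * / INR (S n)).
- intros n; destruct (HD (S n)) as [D1 _]; destruct (HD (S (S n))) as [D2 _].
  rewrite (S_INR (S (S n))) in D2; rewrite (S_INR (S n)) in D1, D2.
  assert (Hk := INR_S_ge_1 n); set (k := INR (S n)) in *.
  assert (G1 := ln_first_difference k Hk).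
  assert (G2 := ln_first_difference (k + 1) ltac:(lra)).
  set (e1 := (L (S n) - _)%C) in D1; set (e2 := (L (S (S n)) - _)%C) in D2.
  assert (R1 : 0 < / (k + 1) <= / k).
  { split; [apply Rinv_0_lt_compat; lra | apply Rinv_le_contravar; lra]. }
  assert (R2 : 0 < / (k + 1 + 1) <= / k).
  { split; [apply Rinv_0_lt_compat; lra | apply Rinv_le_contravar; lra]. }
  assert (D1' : Cmod e1 <= P * / k) by nra.
  assert (D2' : Cmod e2 <= P * / k) by nra.
  set (x := 3 / 2 * ln (k + 1) - 1 / 2 * ln (k + 1 + 1) - ln k).
  replace (RtoC (3 / 4) * L (S n) - RtoC (/ 4) * L (S (S n)) - RtoC (ln k))%C
    with (RtoC x + (RtoC (3 / 4) * e1 - RtoC (/ 4) * e2))%C.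
  + apply Rle_trans with (1 := Cmod_triangle _ _).
    assert (B := Cmod_triangle_minus (RtoC (3 / 4) * e1) (RtoC (/ 4) * e2)).
    rewrite !Cmod_mult, !Cmod_R, (Rabs_pos_eq (3 / 4)), (Rabs_pos_eq (/ 4)) in B by lra.
    assert (Hx : Cmod (RtoC x) <= 5 / 2 * / k).
    { rewrite Cmod_R; apply Rabs_le_between in G1; apply Rabs_le_between in G2.
      apply Rabs_le; unfold x; lra. }
    lra.
  + assert (Ex : RtoC x = (RtoC (3 / 4) * RtoC (2 * ln (k + 1)) 
      - RtoC (/ 4) * RtoC (2 * ln (k + 1 + 1)) - RtoC (ln k))%C).
    { rewrite <- !RtoC_mult, <- !RtoC_minus; f_equal; unfold x; field. }
    rewrite Ex; unfold e1, e2; ring.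
- replace (Finite 0) with (Finite ((5 / 2 + P) * 0)) by (f_equal; ring).
  apply is_lim_seq_mult'; [apply is_lim_seq_const | apply is_lim_seq_inv_INR_S].
Qed.

Lemma altprod_one_plus_div (a : C) (N : nat) : (forall n : nat, a <> (- RtoC (INR n))%C) ->
  altprod (fun m => 1 + a / RtoC (INR m))%C N =
  (altprod (fun m => Cexp (- (a / RtoC (INR m))) * (1 + a / RtoC (INR m)))%C N
   * Cexp (a * RtoC (alt_harmonic N)))%C.
Proof.
intros Ha.
rewrite altprod_mult.
- rewrite altprod_Cexp_div, Cexp_opp.
  field; apply Cexp_neq_0.
- intros m; apply Cexp_neq_0.
- intros m; now apply one_plus_div_neq_0.
Qed.

Lemma altprod_shifted_even (a b : C) (N : nat) :
  (forall n : nat, a <> (- RtoC (INR n))%C) -> (forall n : nat, b <> (- RtoC (INR n))%C) ->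
  altprod (fun m => (RtoC (INR m) + a) * (RtoC (INR m) + b))%C (2 * N) =
  (/ RtoC (wallis N) ^ 2 * (altprod (fun m => 1 + a / RtoC (INR m))%C (2 * N)
     * altprod (fun m => 1 + b / RtoC (INR m))%C (2 * N)))%C.
Proof.
intros Ha Hb.
assert (W : RtoC (wallis N) <> 0%C).
{ intros H; injection H; pose proof (wallis_pos N); lra. }
rewrite altprod_ext with (w := fun m => (RtoC (INR m) * RtoC (INR m)
  * ((1 + a / RtoC (INR m)) * (1 + b / RtoC (INR m))))%C).
2: { intros m; field; apply RtoC_INR_S_neq_0. }
rewrite altprod_mult, !altprod_mult, !altprod_INR_even.
- field; exact W.
- intros m; now apply one_plus_div_neq_0.
- intros m; now apply one_plus_div_neq_0.
- intros m; apply RtoC_INR_S_neq_0.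
- intros m; apply RtoC_INR_S_neq_0.
- intros m; apply Cmult_neq_0; apply RtoC_INR_S_neq_0.
- intros m; apply Cmult_neq_0; now apply one_plus_div_neq_0.
Qed.

Lemma shifted_neq_0 (a : C) (m : nat) :
  (forall n : nat, a <> (- RtoC (INR n))%C) -> (RtoC (INR m) + a)%C <> 0%C.
Proof.
intros Ha H; apply (Ha m).
transitivity ((RtoC (INR m) + a) - RtoC (INR m))%C; [ring | rewrite H; ring].
Qed.

(** By [csum_alt] the exponential of the accelerated sum is the limit of the partial
    products up to [2 * N] divided by [2 * N + 1].  Writing
    [m + a = m * (1 + a / m)] splits them into the square of the Wallis product,
    which with the division by [2 * N + 1] gives [PI / 2], and two inverses of
    partial products of [mod_gamma]. *)
Theorem Cexp_altreg_value (a b c : C) (L : nat -> C) :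
  (forall n : nat, a <> (- RtoC (INR n))%C) -> (forall n : nat, b <> (- RtoC (INR n))%C) ->
  log_asymp c L ->
  (forall m, Cexp (L m) = ((RtoC (INR m) + a) * (RtoC (INR m) + b))%C) ->
  Cexp (altreg L) = ((RtoC PI / 2) / (mod_gamma a * mod_gamma b))%C.
Proof.
intros Ha Hb HL HE.
destruct (mod_gamma_factor_limit a Ha) as [Qa [Na [Ca Ea]]].
destruct (mod_gamma_factor_limit b Hb) as [Qb [Nb [Cb Eb]]].
set (A := fun m => ((RtoC (INR m) + a) * (RtoC (INR m) + b))%C).
set (ga := altprod (fun m => Cexp (- (a / RtoC (INR m))) * (1 + a / RtoC (INR m)))%C) in *.
set (gb := altprod (fun m => Cexp (- (b / RtoC (INR m))) * (1 + b / RtoC (INR m)))%C) in *.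
set (e := fun n => (RtoC (3 / 4) * L (S n) - RtoC (/ 4) * L (S (S n)) - RtoC (ln (INR (S n))))%C).
assert (Ce : Ccv e 0%C) by exact (altreg_boundary c L HL).
set (T := fun n => (RtoC (3 / 4) * L 0%nat - RtoC (/ 4) * L 1%nat
  + RtoC (/ 4) * csum (alt (diff2 L)) n)%C).
assert (CT : Ccv T (altreg L)).
{ apply Ccv_plus; [apply Ccv_const | apply Ccv_mult; [apply Ccv_const | now apply (altreg_cv c)]]. }
assert (Hphi : filterlim (fun N => (2 * N)%nat) eventually eventually).
{ apply eventually_subseq; intros n; lia. }
assert (a0 : a <> 0%C) by (intros H; apply (Ha 0%nat); rewrite H; simpl; ring).
assert (b0 : b <> 0%C) by (intros H; apply (Hb 0%nat); rewrite H; simpl; ring).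
assert (HA : forall m, A m <> 0%C) by (intros m; apply Cmult_neq_0; now apply shifted_neq_0).
(* Only the even partial sums are used: there the boundary term of [csum_alt] has
   sign [+], and the products of integers are exactly those of Wallis. *)
assert (ET : forall N, Cexp (T (2 * N)%nat) =
  (a * b * RtoC (wallis N ^ 2 / INR (2 * N + 1)) * Cexp (- e (2 * N)%nat)
   * / (ga (2 * N)%nat * Cexp (a * RtoC (alt_harmonic (2 * N)))
        * (gb (2 * N)%nat * Cexp (b * RtoC (alt_harmonic (2 * N))))))%C).
{ intros N.
  assert (Hs := csum_alt L (2 * N)).
  assert (P1 : (RtoC (-1) ^ (2 * N))%C = 1%C) by (rewrite <- RtoC_pow, pow_1_even; reflexivity).
  rewrite P1 in Hs.
  replace (T (2 * N)%nat)
    with (csum (alt L) (2 * N) + (- e (2 * N)%nat + - RtoC (ln (INR (S (2 * N))))))%C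
    by (rewrite Hs; unfold T, e; ring).
  rewrite !Cexp_plus.
  assert (Hn : 0 < INR (S (2 * N))) by (apply lt_0_INR; lia).
  rewrite (Cexp_opp (RtoC (ln _))), Cexp_R, exp_ln by exact Hn.
  destruct (Cexp_csum_alt A L (2 * N) HE HA) as [-> HAn].
  replace (2 * N + 1)%nat with (S (2 * N)) by lia.
  revert HAn; unfold A at 1 3; rewrite altprod_shifted_even, !altprod_one_plus_div by assumption.
  fold ga gb; intros HAn.
  assert (W : RtoC (wallis N) <> 0%C).
  { intros H; injection H; pose proof (wallis_pos N); lra. }
  assert (Wn := RtoC_INR_S_neq_0 (2 * N)).
  rewrite RtoC_div, RtoC_pow by lra.
  unfold A; simpl (INR 0).
  assert (HG : (ga (2 * N)%nat * Cexp (a * RtoC (alt_harmonic (2 * N)))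
     * (gb (2 * N)%nat * Cexp (b * RtoC (alt_harmonic (2 * N)))))%C <> 0%C).
  { intros H; apply HAn; rewrite H; ring. }
  set (G := (ga (2 * N)%nat * _ * _)%C) in *.
  field; auto. }
apply (Ccv_unique (fun N => Cexp (T (2 * N)%nat))).
- apply Ccv_Cexp, (Ccv_subseq T _ (fun N => (2 * N)%nat)); assumption.
- apply Ccv_ext with (1 := fun N => eq_sym (ET N)).
  assert (n2 : RtoC 2 <> 0%C) by (intros H; injection H; lra).
  replace ((RtoC PI / 2) / (mod_gamma a * mod_gamma b))%C
    with (a * b * RtoC (PI / 2) * Cexp (- 0)
      * / (Qa * Cexp (a * RtoC (ln 2)) * (Qb * Cexp (b * RtoC (ln 2)))))%C.
  2: { rewrite Ea, Eb, RtoC_div by lra.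
    replace (- RtoC 0)%C with (RtoC 0) by ring; rewrite Cexp_0.
    field; repeat split; auto using Cexp_neq_0. }
  assert (Ch : Ccv (fun N => RtoC (alt_harmonic (2 * N))) (RtoC (ln 2)))
    by apply Ccv_RtoC, alt_harmonic_even_limit.
  apply Ccv_mult; [apply Ccv_mult; [apply Ccv_mult |] |].
  + apply Ccv_const.
  + apply Ccv_RtoC, wallis_limit.
  + apply Ccv_Cexp, Ccv_opp, (Ccv_subseq e _ (fun N => (2 * N)%nat)); assumption.
  + apply Ccv_inv; [repeat apply Cmult_neq_0; auto using Cexp_neq_0 |].
    apply Ccv_mult; apply Ccv_mult.
    * now apply (Ccv_subseq ga _ (fun N => (2 * N)%nat)).
    * apply Ccv_Cexp, Ccv_mult; [apply Ccv_const | exact Ch].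
    * now apply (Ccv_subseq gb _ (fun N => (2 * N)%nat)).
    * apply Ccv_Cexp, Ccv_mult; [apply Ccv_const | exact Ch].
Qed.

Lemma shifted_factor (a : C) (m : nat) :
  (RtoC (INR m) + a)%C = (RtoC (INR (S m)) * (1 + (a - 1) * RtoC (/ INR (S m))))%C.
Proof.
rewrite RtoC_inv by (apply not_0_INR; lia).
assert (H := RtoC_INR_S_neq_0 m).
transitivity (RtoC (INR (S m)) + (a - 1))%C; [rewrite S_INR, RtoC_plus; ring | field; exact H].
Qed.

(** * The two choices of logarithm *)

Lemma log_asymp_sum_of_logs (a b : C) :
  (forall n : nat, a <> (- RtoC (INR n))%C) -> (forall n : nat, b <> (- RtoC (INR n))%C) ->
  log_asymp (a + b - 2)
    (fun m => Clog (RtoC (INR m) + a) + Clog (RtoC (INR m) + b))%C.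
Proof.
intros Ha Hb.
destruct (Clog_1_plus_div (a - 1)) as [Na Ka]; destruct (Clog_1_plus_div (b - 1)) as [Nb Kb].
apply (inv_sq_bound_of_eventually _ (576 * Cmod (a - 1) ^ 2 + 576 * Cmod (b - 1) ^ 2) (max Na Nb)).
intros m Hm; specialize (Ka m ltac:(lia)); specialize (Kb m ltac:(lia)).
assert (K : forall z : C, (forall n : nat, z <> (- RtoC (INR n))%C) ->
  Clog (RtoC (INR m) + z) = (RtoC (ln (INR (S m))) + Clog (1 + (z - 1) * RtoC (/ INR (S m))))%C).
{ intros z Hz; rewrite shifted_factor; apply Clog_pos_scal; [apply lt_0_INR; lia |].
  intros H; apply (shifted_neq_0 z m Hz); rewrite shifted_factor, H; ring. }
rewrite (K a Ha), (K b Hb).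
set (ua := (Clog (1 + (a - 1) * _) - _)%C) in Ka; set (ub := (Clog (1 + (b - 1) * _) - _)%C) in Kb.
match goal with |- Cmod ?z <= _ => replace z with (ua + ub)%C end.
- apply Rle_trans with (1 := Cmod_triangle _ _); lra.
- unfold ua, ub; rewrite RtoC_mult; ring.
Qed.

Lemma log_asymp_log_of_product (a b : C) :
  (forall n : nat, a <> (- RtoC (INR n))%C) -> (forall n : nat, b <> (- RtoC (INR n))%C) ->
  log_asymp (a + b - 2) (fun m => Clog ((RtoC (INR m) + a) * (RtoC (INR m) + b))).
Proof.
intros Ha Hb.
set (c := (a + b - 2)%C); set (d := ((a - 1) * (b - 1))%C).
pose proof (Cmod_ge_0 c); pose proof (Cmod_ge_0 d).
destruct (eventually_INR_ge (2 * (Cmod c + Cmod d))) as [N HN].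
apply (inv_sq_bound_of_eventually _ (576 * (Cmod c + Cmod d) ^ 2 + Cmod d) N).
intros m Hm; specialize (HN m Hm).
assert (Hr := inv_INR_S_bounds m).
assert (Hn : 0 < INR (S m)) by (apply lt_0_INR; lia).
set (r := / INR (S m)) in *.
set (z := (c * RtoC r + d * RtoC r ^ 2)%C).
assert (E : ((RtoC (INR m) + a) * (RtoC (INR m) + b))%C
  = (RtoC (INR (S m) * INR (S m)) * (1 + z))%C).
{ rewrite !shifted_factor; fold r; rewrite RtoC_mult; unfold z, c, d; ring. }
assert (Hz1 : (1 + z)%C <> 0%C).
{ intros H'; rewrite H' in E.
  apply (Cmult_neq_0 _ _ (shifted_neq_0 a m Ha) (shifted_neq_0 b m Hb)); rewrite E; ring. }
assert (Hz : Cmod z <= (Cmod c + Cmod d) * r).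
{ apply Rle_trans with (1 := Cmod_triangle _ _).
  rewrite !Cmod_mult, Cmod_pow, Cmod_R, Rabs_pos_eq by lra.
  assert (r ^ 2 <= r) by nra. nra. }
assert (Hz2 : Cmod z <= / 2).
{ apply Rle_trans with (1 := Hz).
  apply Rmult_le_reg_r with (INR (S m)); [exact Hn |].
  unfold r; rewrite Rmult_assoc, Rinv_l by lra; lra. }
assert (T := Clog_1_plus_taylor z Hz2).
rewrite E, Clog_pos_scal, ln_mult by nra || assumption.
match goal with |- Cmod ?w <= _ => replace w with ((Clog (1 + z) - z) + d * RtoC r ^ 2)%C end.
2: { unfold z; rewrite RtoC_plus, RtoC_mult; ring. }
apply Rle_trans with (1 := Cmod_triangle _ _).
rewrite Cmod_mult, Cmod_pow, Cmod_R, Rabs_pos_eq by lra.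
assert (Cmod z ^ 2 <= (Cmod c + Cmod d) ^ 2 * r ^ 2).
{ rewrite <- Rpow_mult_distr; apply pow_incr; split; [apply Cmod_ge_0 | exact Hz]. }
lra.
Qed.

Theorem corollary3p22 (x y : C)
  (hplus : forall n : nat, (x + Ci * y)%C <> (- INR n)%C)
  (hminus : forall n : nat, (x - Ci * y)%C <> (- INR n)%C) :
  let v := ((PI / 2) / (mod_gamma (x + Ci * y) * mod_gamma (x - Ci * y)))%C in
  is_zeta_prod (fun m : nat => [((INR m + x) ^ 2 + y ^ 2)%C]) v /\
  is_zeta_prod
    (fun m : nat => [(INR m + x + Ci * y)%C; (INR m + x - Ci * y)%C]) v.
Proof.
cbv zeta.
set (a := (x + Ci * y)%C) in *; set (b := (x - Ci * y)%C) in *.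
assert (Ci2 : (Ci * Ci = - (1))%C) by (unfold Ci, Cmult, Copp, RtoC; simpl; f_equal; ring).
assert (Es : forall m, ((INR m + x) ^ 2 + y ^ 2)%C = ((INR m + a) * (INR m + b))%C).
{ intros m; transitivity ((INR m + x) * (INR m + x) - (Ci * Ci) * (y * y))%C;
    [rewrite Ci2; ring | unfold a, b; ring]. }
assert (Ea : forall m, (INR m + x + Ci * y)%C = (INR m + a)%C) by (intros m; unfold a; ring).
assert (Eb : forall m, (INR m + x - Ci * y)%C = (INR m + b)%C) by (intros m; unfold b; ring).
assert (Na := fun m => shifted_neq_0 a m hplus).
assert (Nb := fun m => shifted_neq_0 b m hminus).
assert (Nab := fun m => Cmult_neq_0 _ _ (Na m) (Nb m)).
split.
- assert (HL := log_asymp_log_of_product a b hplus hminus).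
  rewrite <- (Cexp_altreg_value a b _ _ hplus hminus HL)
    by (intros m; now apply Cexp_Clog).
  apply is_zeta_prod_of_logs with (3 := HL).
  + intros m z [<- | []]; rewrite Es; apply Nab.
  + intros m s; unfold zeta_term, Cprod, Cpower; cbn [map fold_right].
    rewrite Es; ring.
- assert (HL := log_asymp_sum_of_logs a b hplus hminus).
  rewrite <- (Cexp_altreg_value a b _ _ hplus hminus HL)
    by (intros m; rewrite Cexp_plus, !Cexp_Clog by auto; reflexivity).
  apply is_zeta_prod_of_logs with (3 := HL).
  + intros m z [<- | [<- | []]]; rewrite ?Ea, ?Eb; auto.
  + intros m s; unfold zeta_term, Cprod, Cpower; cbn [map fold_right].
    rewrite Ea, Eb, Cmult_1_r, <- Cexp_plus; f_equal; ring.
Qed.
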